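(* Fix an eigenpair $(\lambda,u)$ of the nonlinear eigenvalue problem. Let $(\lambda_{h_n},u_{h_n})$ be the eigenpair approximation produced by the Eigenvalue Multigrid Scheme described in the context, where either (i) all correction steps are fixed-point correction steps, and Assumptions A1, A2 and B (stated in the context) hold; or (ii) all correction steps are Newton correction steps, and Assumptions A1, A2 and C (stated in the context) hold. Let $(\bar\lambda_{h_n},\bar u_{h_n})\in\mathbb{R}\times V_{h_n}$ be the approximation of $(\lambda,u)$ by the direct finite element method in $V_{h_n}$. Then there is a constant $C>0$ independent of the mesh sizes (the constant hidden in the inequalities $\lesssim$ concerned) such that, under the condition $C\beta^2\eta_a(V_H)<1$, $$\|\bar u_{h_n}-u_{h_n}\|_1\lesssim \beta^2\,\eta_a(V_{h_n})\,\delta_{h_n}(u),$$ $$|\bar\lambda_{h_n}-\lambda_{h_n}|+\|\bar u_{h_n}-u_{h_n}\|_0\lesssim \eta_a(V_{h_n})\,\delta_{h_n}(u).$$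
   Context: **Notation.** $x\lesssim y$ means $x\le C_1y$, and $x\approx y$ means $c_3x\le y\le C_3x$, with constants independent of the mesh sizes (in particular of the level indices $k$ and $n$). $\Omega\subset\mathbb{R}^d$ ($d=2,3$) is the computing domain, $V=H_0^1(\Omega)$, $\|\cdot\|_s$ is the $H^s(\Omega)$ norm ($s=0,1$), and $(\cdot,\cdot)$ is the $L^2(\Omega)$ inner product. **Problem.** $f(x,u)$ is a smooth enough function such that the following eigenvalue problem has only real eigenvalues: find $(\lambda,u)\in\mathbb{R}\times V$ with $b(u,u)=1$ and $a(u,v)=\lambda b(u,v)$ for all $v\in V$, where $$a(u,v)=\int_\Omega(\nabla u\cdot\nabla v+f(x,u)v)\,d\Omega,\qquad b(u,v)=\int_\Omega uv\,d\Omega .$$ (This is the weak form of $-\Delta u+f(x,u)=\lambda u$ in $\Omega$, $u=0$ on $\partial\Omega$, $\int_\Omega u^2=1$.) An eigenpair $(\lambda,u)$ is fixed, and all discrete eigenpairs below are the approximations of this eigenpair. $f_v(x,v)$ (also written $f_u$) denotes the derivative of $f$ in its second argument. **Finite element spaces.** $V_h\subset V$ are linear finite element spaces on shape-regular meshes $\mathcal{T}_h$ of mesh size $h$, with $\lim_{h\to0}\inf_{v\in V_h}\|w-v\|_1=0$ for every $w\in V$. Put $\delta_h(u)=\inf_{v_h\in V_h}\|u-v_h\|_1$. The direct finite element approximation in $V_h$ is $(\bar\lambda_h,\bar u_h)\in\mathbb{R}\times V_h$ with $b(\bar u_h,\bar u_h)=1$ and $a(\bar u_h,v_h)=\bar\lambda_h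 b(\bar u_h,v_h)$ for all $v_h\in V_h$. **Assumption A1.** $\|u-\bar u_h\|_1\lesssim\delta_h(u)$ and $|\lambda-\bar\lambda_h|+\|u-\bar u_h\|_0\lesssim\eta_a(V_h)\|u-\bar u_h\|_1$, where $\eta_a(V_h)$ depends on the finite-dimensional space $V_h$, $\lim_{h\to0}\eta_a(V_h)=0$, and $\eta_a(\widetilde V_h)\le\eta_a(V_h)$ if $V_h\subset\widetilde V_h\subset V$. **Assumption A2.** If $V^h$ is a subspace of $V_h$ and $(\lambda^h,u^h)\in\mathbb{R}\times V^h$ is the eigenpair approximation with $b(u^h,u^h)=1$ and $a(u^h,v^h)=\lambda^hb(u^h,v^h)$ for all $v^h\in V^h$, then $\|\bar u_h-u^h\|_1\lesssim\inf_{v^h\in V^h}\|\bar u_h-v^h\|_1$ and $|\bar\lambda_h-\lambda^h|+\|\bar u_h-u^h\|_0\lesssim\eta_a(V^h)\|\bar u_h-u^h\|_1$. **Assumption B.** $|(f(x,w)-f(x,v),\psi)|\lesssim\|w-v\|_0\|\psi\|_1$ for all $w,v,\psi\in V$. **Assumption C.** $|(f(x,w)-f(x,v)-f_v(x,v)(w-v),\psi)|\lesssim\|w-v\|_0\|\psi\|_1$ for all $w,v,\psi\in V$. **Sequence of spaces.** $V_H$ is the linear finite element space on a coarse mesh $\mathcal{T}_H$. $\mathcal{T}_{h_1}$ is obtained from $\mathcal{T}_H$ by regular refinement, and $\mathcal{T}_{h_k}$ from $\mathcal{T}_{h_{k-1}}$ by regular refinement (each element produces $\beta^d$ subelements, $\beta>1$),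 so $h_k\approx\frac1\beta h_{k-1}$ for $k=2,\dots,n$. The corresponding linear finite element spaces satisfy $V_H\subseteq V_{h_1}\subset V_{h_2}\subset\cdots\subset V_{h_n}$ and $\delta_{h_k}(u)\approx\frac1\beta\delta_{h_{k-1}}(u)$, $k=2,\dots,n$. **Fixed-point correction step** (from $(\lambda_{h_k},u_{h_k})\in\mathbb{R}\times V_{h_k}$ to $(\lambda_{h_{k+1}},u_{h_{k+1}})$). Let $\widehat u_{h_{k+1}}\in V_{h_{k+1}}$ solve $(\nabla\widehat u_{h_{k+1}},\nabla v)=\lambda_{h_k}b(u_{h_k},v)-(f(x,u_{h_k}),v)$ for all $v\in V_{h_{k+1}}$. A multigrid method yields $\widetilde u_{h_{k+1}}\in V_{h_{k+1}}$ with $\|\widehat u_{h_{k+1}}-\widetilde u_{h_{k+1}}\|_1\lesssim\eta_a(V_{h_k})\delta_{h_k}(u)$. Then put $V_{H,h_{k+1}}=V_H+\mathrm{span}\{\widetilde u_{h_{k+1}}\}$ and let $(\lambda_{h_{k+1}},u_{h_{k+1}})\in\mathbb{R}\times V_{H,h_{k+1}}$ be the eigenpair approximation with $b(u_{h_{k+1}},u_{h_{k+1}})=1$ and $a(u_{h_{k+1}},v)=\lambda_{h_{k+1}}b(u_{h_{k+1}},v)$ for all $v\in V_{H,h_{k+1}}$ (the approximation of Assumption A2 with $V_h=V_{h_{k+1}}$ and $V^h=V_{H,h_{k+1}}$). **Newton correction step.** Put $a_{h_k}(w,v)=(\nabla w,\nabla v)+(f_u(x,u_{h_k})w,v)$.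 For this step it is assumed that $L_u=-\Delta+f_u(x,u)$ is nonsingular and that $u_{h_k}$ is close enough to $u$ that $\sup_{0\ne v\in V_{h_{k+1}}}a_{h_k}(w,v)/\|v\|_1\gtrsim\|w\|_1$ for all $w\in V_{h_{k+1}}$ and $|a_{h_k}(w,v)|\lesssim\|w\|_1\|v\|_1$ for all $w,v\in V$. Let $\widehat e_{h_{k+1}}\in V_{h_{k+1}}$ solve $a_{h_k}(\widehat e_{h_{k+1}},v)=\lambda_{h_k}b(u_{h_k},v)-(\nabla u_{h_k},\nabla v)-(f(x,u_{h_k}),v)$ for all $v\in V_{h_{k+1}}$. A multigrid method yields $\widetilde e_{h_{k+1}}\in V_{h_{k+1}}$ with $\|\widehat e_{h_{k+1}}-\widetilde e_{h_{k+1}}\|_1\lesssim\eta_a(V_{h_k})\delta_{h_k}(u)$. Set $\widetilde u_{h_{k+1}}=u_{h_k}+\widetilde e_{h_{k+1}}$, then define $V_{H,h_{k+1}}$ and $(\lambda_{h_{k+1}},u_{h_{k+1}})$ exactly as in the fixed-point correction step. **Eigenvalue Multigrid Scheme.** (1) Construct the nested linear finite element spaces $V_{h_1},\dots,V_{h_n}$ on the successively refined meshes $\mathcal{T}_{h_1},\dots,\mathcal{T}_{h_n}$, such that $V_H\subseteq V_{h_1}\subset V_{h_2}\subset\cdots\subset V_{h_n}$ and $\delta_{h_k}(u)\approx\frac1\beta\delta_{h_{k-1}}(u)$ for $k=2,\dots,n$. (2) Solve the nonlinear eigenvalue problem directly in $V_{h_1}$: find $(\lambda_{h_1},u_{h_1})\in\mathbb{R}\times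 V_{h_1}$ with $b(u_{h_1},u_{h_1})=1$ and $a(u_{h_1},v)=\lambda_{h_1}b(u_{h_1},v)$ for all $v\in V_{h_1}$; thus $(\lambda_{h_1},u_{h_1})=(\bar\lambda_{h_1},\bar u_{h_1})$. (3) For $k=1,\dots,n-1$ obtain $(\lambda_{h_{k+1}},u_{h_{k+1}})$ from $(\lambda_{h_k},u_{h_k})$ by a correction step. The output is $(\lambda_{h_n},u_{h_n})$.
   Formalization: Adds the assumption η_a(V_{h_k}) ≲ β η_a(V_{h_{k+1}}) for 1 ≤ k < n, the analogue of the stated δ relation; without it η_a may drop arbitrarily between levels and the first estimate fails. η_a ≥ 0 is made explicit. *)

(* Defs.v *)
From HB Require Import structures.
From mathcomp Require Import all_boot all_order all_algebra.
From mathcomp Require Import all_classical all_reals all_analysis.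
Set Implicit Arguments.
Unset Strict Implicit.
Unset Printing Implicit Defensive.
Import Order.TTheory GRing.Theory Num.Theory.
Import numFieldNormedType.Exports.
Local Open Scope classical_set_scope.
Local Open Scope ring_scope.

(* The product sigma-algebra on R^n: the library equips n.-tuple R with it,
   but it is 'rV[R]_n that carries the topology and the derivatives. *)
Definition rV_display : measure_display.
Proof. exact: default_measure_display. Qed.

Section measurable_rV.
Variables (R : realType) (n : nat).

Let coor : 'I_n -> 'rV[R]_n -> R := fun i x => x 0 i.

Let rV_set0 : g_sigma_preimage coor set0.
Proof. exact: sigma_algebra0. Qed.

Let rV_setC A : g_sigma_preimage coor A -> g_sigma_preimage coor (~` A).
Proof. exact: sigma_algebraC. Qed.

Let rV_bigcup (F : _^nat) : (forall i, g_sigma_preimage coor (F i)) ->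
  g_sigma_preimage coor (\bigcup_i (F i)).
Proof. exact: sigma_algebra_bigcup. Qed.

HB.instance Definition _ := @isMeasurable.Build rV_display
  'rV[R]_n (g_sigma_preimage coor) rV_set0 rV_setC rV_bigcup.

Lemma measurable_coor (i : 'I_n) :
  measurable_fun [set: 'rV[R]_n] (fun x : 'rV[R]_n => x 0 i).
Proof.
move=> _ Y mY; rewrite setTI; apply: sub_sigma_algebra => /=.
rewrite -bigcup_seq/=; exists i => /=; first by rewrite mem_index_enum.
by exists Y => //; rewrite setTI.
Qed.

Lemma measurable_fun_rVP d (T : measurableType d) (f : T -> 'rV[R]_n) :
  measurable_fun [set: T] f <->
  forall i, measurable_fun [set: T] (fun x => f x 0 i).
Proof.
split=> [mf i|mf].
  exact: (measurableT_comp (measurable_coor i) mf).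
suff H : g_sigma_preimage coor `<=` [set A | measurable (f @^-1` A)].
  by move=> _ A mA; rewrite setTI; exact: H.
apply: smallest_sub.
  split => //= [|A mA|F mF].
  - by rewrite preimage_set0.
  - by rewrite setTD -preimage_setC; exact: measurableC.
  - by rewrite preimage_bigcup; exact: bigcup_measurable.
rewrite -bigcup_seq => A [i _ [B mB <-]] /=.
by rewrite setTI -comp_preimage -[X in measurable X]setTI; exact: mf.
Qed.

End measurable_rV.

Lemma sigma_finite_prod d1 d2 (T1 : measurableType d1) (T2 : measurableType d2)
    (R : realType) (m1 : {sigma_finite_measure set T1 -> \bar R})
    (m2 : {sigma_finite_measure set T2 -> \bar R}) :
  sigma_finite setT (m1 \x m2)%E.
Proof.
have /sigma_finiteP[F [TF ndF Foo]] := sigma_finiteT m1.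
have /sigma_finiteP[G [TG ndG Goo]] := sigma_finiteT m2.
exists (fun k => F k `*` G k).
  rewrite -setXTT TF TG predeqE => -[x y]; split.
    move=> [/= [i _ Fix] [k _ Gky]]; exists (maxn i k) => //; split.
    - by move: x Fix; exact/subsetPset/ndF/leq_maxl.
    - by move: y Gky; exact/subsetPset/ndG/leq_maxr.
  by move=> [i _ []/= ? ?]; split; exists i.
move=> k; have [? ?] := Foo k; have [? ?] := Goo k.
split; first exact: measurableX.
by rewrite product_measure1E// lte_mul_pinfty// ge0_fin_numE.
Qed.

Section lebesgue_rV_step.
Variable R : realType.

Definition consr n (p : R * 'rV[R]_n) : 'rV[R]_n.+1 :=
  row_mx (const_mx p.1 : 'rV[R]_1) p.2.
Definition splitr n (x : 'rV[R]_n.+1) : R * 'rV[R]_n :=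
  (x 0 ord0, \row_i x 0 (lift ord0 i)).

Lemma consrK n : cancel (@consr n) (@splitr n).
Proof.
move=> [t x]; rewrite /splitr /consr; congr pair => /=.
  rewrite (_ : ord0 = lshift n (0 : 'I_1)); last exact: val_inj.
  by rewrite (row_mxEl (const_mx t : 'rV[R]_1) x) mxE.
apply/rowP => i; rewrite mxE (_ : lift ord0 i = rshift 1 i); last exact: val_inj.
by rewrite (row_mxEr (const_mx t : 'rV[R]_1) x).
Qed.

Lemma measurable_consr n : measurable_fun [set: R * 'rV[R]_n] (@consr n).
Proof.
apply/measurable_fun_rVP => i.
case: (split_ordP (i : 'I_(1 + n))) => j ->.
  rewrite (_ : (fun _ => _) = fst) //.
  by apply/funext => -[t x]; rewrite /consr (row_mxEl (const_mx t : 'rV[R]_1) x) mxE.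
rewrite (_ : (fun _ => _) = (fun x : 'rV[R]_n => x 0 j) \o snd).
  exact: (measurableT_comp (measurable_coor j)).
by apply/funext => -[t x]; rewrite /consr (row_mxEr (const_mx t : 'rV[R]_1) x).
Qed.

Lemma measurable_splitr n : measurable_fun [set: 'rV[R]_n.+1] (@splitr n).
Proof.
apply: measurable_fun_pair; first exact: (measurable_coor ord0).
apply/measurable_fun_rVP => i.
rewrite (_ : (fun _ => _) = (fun x : 'rV[R]_n.+1 => x 0 (lift ord0 i))).
  exact: measurable_coor.
by apply/funext => x; rewrite mxE.
Qed.

Definition cons_measure n (m : {sigma_finite_measure set 'rV[R]_n -> \bar R}) :
    set 'rV[R]_n.+1 -> \bar R :=
  pushforward (@lebesgue_measure R \x m)%E (@consr n).

Section instances.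
Variables (n : nat) (m : {sigma_finite_measure set 'rV[R]_n -> \bar R}).
Local Open Scope ereal_scope.

Let mconsr (A : set 'rV[R]_n.+1) : measurable A -> measurable (@consr n @^-1` A).
Proof. by move=> mA; rewrite -[X in measurable X]setTI; exact: measurable_consr. Qed.

Let cm0 : cons_measure m set0 = 0.
Proof. by rewrite /cons_measure /pushforward preimage_set0 measure0. Qed.

Let cm_ge0 A : 0 <= cons_measure m A.
Proof. by rewrite /cons_measure /pushforward; exact: measure_ge0. Qed.

Let cm_sigma_additive : semi_sigma_additive (cons_measure m).
Proof.
move=> F mF tF mUF; rewrite /cons_measure /pushforward preimage_bigcup.
apply: measure_semi_sigma_additive.
- by move=> k; exact: mconsr.
- apply/trivIsetP => /= i j _ _ ij; rewrite -preimage_setI.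
  by move/trivIsetP : tF => /(_ _ _ _ _ ij) ->//; rewrite preimage_set0.
- by rewrite -preimage_bigcup; exact: mconsr.
Qed.

HB.instance Definition _ := isMeasure.Build _ _ _
  (cons_measure m) cm0 cm_ge0 cm_sigma_additive.

Let cm_sigma_finite : sigma_finite setT (cons_measure m).
Proof.
have [F UF mF] := sigma_finite_prod (@lebesgue_measure R) m.
exists (fun k => @splitr n @^-1` F k).
  by rewrite -preimage_bigcup -UF preimage_setT.
move=> k; have [mFk Fkoo] := mF k; split.
  by rewrite -[X in measurable X]setTI; exact: measurable_splitr.
rewrite /cons_measure /pushforward -comp_preimage.
by rewrite (_ : @splitr n \o @consr n = id) //; apply/funext/consrK.
Qed.

HB.instance Definition _ := Measure_isSigmaFinite.Build _ _ _
  (cons_measure m) cm_sigma_finite.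

End instances.
End lebesgue_rV_step.

(* n-dimensional Lebesgue measure, via R^(n+1) = R x R^n. *)
Fixpoint leb (R : realType) (n : nat) : {sigma_finite_measure set 'rV[R]_n -> \bar R} :=
  if n is k.+1 then cons_measure (leb R k)
  else (\d_ (0 : 'rV[R]_0))%R.

Section geometry.
Variables (R : realType) (d : nat).
Notation pt := 'rV[R]_d.

Definition dot (x y : pt) : R := \sum_(i < d) x 0 i * y 0 i.

(* The library norm of 'rV[R]_d is the max norm. *)
Definition enorm (x : pt) : R := Num.sqrt (dot x x).

Definition domain (Om : set pt) : Prop :=
  [/\ open Om, connected Om, bounded_set Om & Om !=set0].

Definition simplex := 'I_d.+1 -> pt.

Definition barycentric (t : 'I_d.+1 -> R) : Prop :=
  (forall k, 0 <= t k) /\ \sum_k t k = 1.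

Definition hull (s : simplex) : set pt :=
  [set x | exists t, barycentric t /\ x = \sum_k t k *: s k].

Definition common_face (s s' : simplex) : set pt :=
  [set x | exists t, [/\ barycentric t,
     forall k, t k != 0 -> exists l, s k = s' l & x = \sum_k t k *: s k]].

Definition nondegenerate (s : simplex) : Prop :=
  row_free (\matrix_(i < d) (s (lift ord0 i) - s ord0)).

Definition diam (s : simplex) : R :=
  sup [set enorm (z.1 - z.2) | z in hull s `*` hull s].

(* Supremum of the diameters of the balls contained in the simplex. *)
Definition indiam (s : simplex) : R :=
  sup [set 2 * r | r in [set r | 0 <= r /\
    exists x, forall y, enorm (y - x) <= r -> hull s y]].

Record mesh := Mesh { nelem : nat; elem : 'I_nelem -> simplex }.

Definition mesh_size (T : mesh) : R :=
  \big[Num.max/0]_(i < nelem T) diam (elem i).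

Definition triangulation (Om : set pt) (T : mesh) : Prop :=
  [/\ forall i : 'I_(nelem T), nondegenerate (elem i),
      \bigcup_(i in [set: 'I_(nelem T)]) hull (elem i) = closure Om &
      forall i j : 'I_(nelem T), i <> j ->
        hull (elem i) `&` hull (elem j) = common_face (elem i) (elem j) /\
        exists k, forall l, elem i k <> elem j l].

Definition shape_regular (sigma : R) (T : mesh) : Prop :=
  forall i : 'I_(nelem T), diam (elem i) <= sigma * indiam (elem i).

(* Each element of T is subdivided into beta^d elements of T'; beta need not be
   an integer. *)
Definition regular_refinement (beta : R) (T T' : mesh) : Prop :=
  (forall j : 'I_(nelem T'), exists i : 'I_(nelem T),
     hull (elem j) `<=` hull (elem i)) /\
  (forall i : 'I_(nelem T),
     #|[set j : 'I_(nelem T') | `[< hull (elem j) `<=` hull (elem i) >]]%SET|%:R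
       = beta ^+ d).

End geometry.

Section sobolev.
Variables (R : realType) (d : nat) (Om : set 'rV[R]_d).
Notation pt := 'rV[R]_d.

Definition partial (i : 'I_d) (g : pt -> R) : pt -> R :=
  fun x => 'D_(delta_mx 0 i) g x.

Definition smooth (g : pt -> R) : Prop :=
  forall s : seq 'I_d, continuous (foldr partial g s) /\
    forall i x, derivable (foldr partial g s) x (delta_mx 0 i).

Definition test_function (g : pt -> R) : Prop :=
  smooth g /\
  exists A : set pt, [/\ compact A, A `<=` Om & forall x, ~ A x -> g x = 0].

Definition L2 (g : pt -> R) : Prop :=
  measurable_fun Om g /\ (leb R d).-integrable Om (fun x => (g x ^+ 2)%:E).

(* An element of H^1 is represented by the pair (v, grad v) of representatives
   of a function and of its weak gradient; two pairs denote the same element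
   when norm1 of their difference vanishes. *)
Definition sob : Type := ((pt -> R) * (pt -> pt))%type.

Definition ip (g h : pt -> R) : R := \int[leb R d]_(x in Om) (g x * h x).
Definition gip (v w : sob) : R := \int[leb R d]_(x in Om) dot (v.2 x) (w.2 x).

Definition norm0 (v : sob) : R := Num.sqrt (ip v.1 v.1).
Definition norm1 (v : sob) : R := Num.sqrt (ip v.1 v.1 + gip v v).

Definition smooth_sob (g : pt -> R) : sob := (g, fun x => \row_i partial i g x).

(* H^1_0(Om): the H^1-closure of the test functions. *)
Definition H01 : set sob :=
  [set v : sob | [/\ L2 v.1, forall i, L2 (fun x => v.2 x 0 i) &
    exists phi : nat -> pt -> R, (forall n, test_function (phi n)) /\
      norm1 (smooth_sob (phi n) - v) @[n --> \oo] --> (0 : R)]].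

Definition subspace (W : set sob) : Prop :=
  W 0 /\ forall (c : R) v w, W v -> W w -> W (c *: v + w).

Definition finite_dim (W : set sob) : Prop :=
  exists N (e : 'I_N -> sob), (forall i, W (e i)) /\
    forall v, W v -> exists c : 'I_N -> R, norm1 (v - \sum_i c i *: e i) = 0.

Definition fd_subspace (W : set sob) : Prop :=
  [/\ subspace W, W `<=` H01 & finite_dim W].

Definition add_span (W : set sob) (w : sob) : set sob :=
  [set z : sob | exists (v : sob) (c : R), W v /\ z = v + c *: w].

Definition dist (W : set sob) (w : sob) : R := inf [set norm1 (w - v) | v in W].

(* Linear finite elements: v agrees a.e. with a continuous function w that is
   affine on each element and vanishes on the boundary, and grad v with the
   piecewise constant gradient of w. *)
Definition fespace (T : mesh R d) : set sob :=
  [set v : sob | H01 v /\ exists (w : pt -> R) (c : 'I_(nelem T) -> R)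
      (p : 'I_(nelem T) -> pt),
    [/\ {within closure Om, continuous w},
        forall x, closure Om x -> ~ Om x -> w x = 0,
        forall i x, hull (elem i) x -> w x = c i + dot (p i) x,
        {ae leb R d, forall x, Om x -> v.1 x = w x} &
        forall i, {ae leb R d, forall x, Om x -> hull (elem i) x -> v.2 x = p i}]].

(* fam collects all the meshes, of every size, on which the estimates are to hold
   with the same constants. *)
Definition mesh_family (sigma : R) (fam : set (mesh R d)) : Prop :=
  (forall T, fam T -> triangulation Om T /\ shape_regular sigma T) /\
  (forall w, H01 w -> forall e, 0 < e -> exists2 h0, 0 < h0 &
     forall T, fam T -> mesh_size T < h0 -> dist (fespace T) w < e).

Variable f : pt -> R -> R.

Definition f_v (x : pt) (t : R) : R := derive1 (f x) t.

Definition smooth_nonlinearity : Prop :=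
  [/\ forall x, Om x -> forall t, derivable (f x) t 1,
      {within Om `*` setT, continuous (fun z : pt * R => f z.1 z.2)},
      {within Om `*` setT, continuous (fun z : pt * R => f_v z.1 z.2)} &
      forall w v, H01 w -> H01 v ->
        (leb R d).-integrable Om (fun x => (f x (w.1 x) * v.1 x)%:E)].

Definition a_form (w v : sob) : R :=
  \int[leb R d]_(x in Om) (dot (w.2 x) (v.2 x) + f x (w.1 x) * v.1 x).

Definition b_form (w v : sob) : R := \int[leb R d]_(x in Om) (w.1 x * v.1 x).

(* a_(h_k) for z = u_(h_k); the form of -Laplace + f_u(x, u) for z = u. *)
Definition a_lin (z w v : sob) : R :=
  gip w v + ip (fun x => f_v x (z.1 x) * w.1 x) v.1.

Definition eigenpair (W : set sob) (mu : R) (w : sob) : Prop :=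
  [/\ W w, b_form w w = 1 & forall v, W v -> a_form w v = mu * b_form w v].

Definition assumptionB (K : R) : Prop :=
  forall w v psi, H01 w -> H01 v -> H01 psi ->
    `|ip (fun x => f x (w.1 x) - f x (v.1 x)) psi.1|
      <= K * (norm0 (w - v) * norm1 psi).

(* The first clause makes the pairing in the second one meaningful: the library
   gives a value to the integral of a non-integrable function too. *)
Definition assumptionC (K : R) : Prop :=
  (forall v w psi, H01 v -> H01 w -> H01 psi ->
     (leb R d).-integrable Om (fun x => (f_v x (v.1 x) * w.1 x * psi.1 x)%:E)) /\
  (forall w v psi, H01 w -> H01 v -> H01 psi ->
    `|ip (fun x => f x (w.1 x) - f x (v.1 x) - f_v x (v.1 x) * (w.1 x - v.1 x))
        psi.1|
      <= K * (norm0 (w - v) * norm1 psi)).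

(* -Laplace + f_u(x, u) is an isomorphism from H^1_0 onto its dual. *)
Definition nonsingular (u : sob) : Prop :=
  forall F : sob -> R,
    (forall c v w, H01 v -> H01 w -> F (c *: v + w) = c * F v + F w) ->
    (exists M, forall v, H01 v -> `|F v| <= M * norm1 v) ->
    exists w, [/\ H01 w, forall v, H01 v -> a_lin u w v = F v &
      forall w', H01 w' -> (forall v, H01 v -> a_lin u w' v = F v) ->
        norm1 (w' - w) = 0].

Variables (lam : R) (u : sob).

(* A discrete eigenpair of W need not approximate (lam, u) (other eigenvalues,
   or -u), so [appr W mu w] singles out those that do. *)
Variable appr : set sob -> R -> sob -> Prop.

(* (lamb T, ub T) is the direct approximation on T; eta is eta_a. *)
Variables (fam : set (mesh R d)) (lamb : mesh R d -> R) (ub : mesh R d -> sob).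
Variable eta : set sob -> R.

Definition approximations : Prop :=
  (forall W mu w, appr W mu w -> eigenpair W mu w) /\
  (forall T, fam T -> appr (fespace T) (lamb T) (ub T)).

Definition assumptionA1 (K : R) : Prop :=
  [/\ forall T, fam T ->
        norm1 (u - ub T) <= K * dist (fespace T) u /\
        `|lam - lamb T| + norm0 (u - ub T)
          <= K * (eta (fespace T) * norm1 (u - ub T)),
      forall W, fd_subspace W -> 0 <= eta W,
      forall e, 0 < e -> exists2 h0, 0 < h0 &
        forall T, fam T -> mesh_size T < h0 -> eta (fespace T) < e &
      forall W W', fd_subspace W -> fd_subspace W' -> W `<=` W' ->
        eta W' <= eta W].

Definition assumptionA2 (K : R) : Prop :=
  forall T, fam T -> forall W mu w, subspace W -> W `<=` fespace T ->
    appr W mu w ->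
    norm1 (ub T - w) <= K * dist W (ub T) /\
    `|lamb T - mu| + norm0 (ub T - w) <= K * (eta W * norm1 (ub T - w)).

Inductive correction := FixedPoint | Newton.

Definition correction_assumption (m : correction) (K : R) : Prop :=
  match m with
  | FixedPoint => assumptionB K
  | Newton => assumptionC K /\ nonsingular u
  end.

(* In the steps below W and W' stand for V_(h_k) and V_(h_(k+1)), and s, s' for
   the pairs (lambda, u) on these levels. *)
Definition fixed_point_step (K : R) (VH W W' : set sob) (s s' : R * sob) : Prop :=
  exists uh ut : sob,
    [/\ W' uh,
        forall v, W' v ->
          gip uh v = s.1 * b_form s.2 v - ip (fun x => f x (s.2.1 x)) v.1,
        W' ut,
        norm1 (uh - ut) <= K * (eta W * dist W u) &
        appr (add_span VH ut) s'.1 s'.2].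

Definition newton_step (K : R) (VH W W' : set sob) (s s' : R * sob) : Prop :=
  [/\ forall w, W' w -> norm1 w <=
        K * sup [set a_lin s.2 w v / norm1 v | v in W' `&` [set v | norm1 v != 0]],
      forall w v, H01 w -> H01 v -> `|a_lin s.2 w v| <= K * (norm1 w * norm1 v) &
      exists eh et : sob,
      [/\ W' eh,
          forall v, W' v -> a_lin s.2 eh v =
            s.1 * b_form s.2 v - gip s.2 v - ip (fun x => f x (s.2.1 x)) v.1,
          W' et,
          norm1 (eh - et) <= K * (eta W * dist W u) &
          appr (add_span VH (s.2 + et)) s'.1 s'.2]].

Definition correction_step (m : correction) :=
  match m with FixedPoint => fixed_point_step | Newton => newton_step end.

(* One constant K serves for all the hidden constants of the hypotheses. *)
Definition approx_eq (K x y : R) : Prop := K^-1 * x <= y /\ y <= K * x.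

(* T 1, ..., T n are the meshes of the scheme; T 0 is not used. *)
Definition hierarchy (K beta : R) (n : nat) (TH : mesh R d) (T : nat -> mesh R d)
    : Prop :=
  [/\ (0 < n)%N /\ 1 < beta,
      fam TH /\ forall k, (1 <= k <= n)%N -> fam (T k),
      (exists2 beta1 : R, 1 <= beta1 & regular_refinement beta1 TH (T 1%N)) /\
        forall k, (1 <= k < n)%N -> regular_refinement beta (T k) (T k.+1),
      fespace TH `<=` fespace (T 1%N) /\
        forall k, (1 <= k < n)%N -> fespace (T k) `<=` fespace (T k.+1) &
      forall k, (1 <= k < n)%N ->
        approx_eq K (beta^-1 * mesh_size (T k)) (mesh_size (T k.+1)) /\
        approx_eq K (beta^-1 * dist (fespace (T k)) u)
                    (dist (fespace (T k.+1)) u)].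

Definition multigrid_scheme (m : correction) (K : R) (n : nat) (TH : mesh R d)
    (T : nat -> mesh R d) (s : nat -> R * sob) : Prop :=
  s 1%N = (lamb (T 1%N), ub (T 1%N)) /\
  forall k, (1 <= k < n)%N ->
    correction_step m K (fespace TH) (fespace (T k)) (fespace (T k.+1))
      (s k) (s k.+1).

End sobolev.

(* Main.v *)
Require Import Defs.
From mathcomp Require Import all_boot all_order all_algebra.
From mathcomp Require Import all_classical all_reals all_analysis.
From mathcomp Require Import measurable_realfun.
From mathcomp Require Import ring lra.
Set Implicit Arguments.
Unset Strict Implicit.
Unset Printing Implicit Defensive.
Import Order.TTheory GRing.Theory Num.Theory.
Import numFieldNormedType.Exports.
Local Open Scope classical_set_scope.
Local Open Scope ring_scope.

(** On level [k] write [eps_k = eta (V_k) * dist V_k u].  By induction on [k],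
    [|lamb_k - lam_k| + norm0 (ub_k - u_k) <= eps_k]: Assumption A1 on two
    consecutive levels gives
    [|lamb_(k+1) - lam_k| + norm0 (ub_(k+1) - u_k) <= (2 K^2 + 1) eps_k], and the
    difference of the equations for [ub_(k+1)] and for the corrected function
    bounds the [norm1]-error of the latter by [G * eps_k] (through the Poincare
    inequality for a fixed-point step, through the inf-sup condition for a Newton
    step).  As [eps_k <= K^2 beta^2 eps_(k+1)], Assumption A2 turns this into
    [norm1 (ub_(k+1) - u_(k+1)) <= K^3 G beta^2 eps_(k+1)], and its second part
    restores the induction hypothesis with the factor
    [K^4 G beta^2 eta (V_H) < 1]. *)

(** * Semi-inner products *)

(** A pair in [sob] is not an equivalence class, and the integral of a non-integrable function also
    has a value. Bilinearity is therefore proved under explicit integrability, and Hilbert space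
    arguments are made for forms that are only semidefinite and only linear on a subset. The
    constants are fixed before [beta], the meshes and the number of levels, so nothing may grow
    along the levels. This is why the induction hypothesis has constant 1 and why the smallness
    condition must restore exactly that constant; the [norm1] estimate is never fed back. Of the
    factor [beta ^+ 2], one [beta] is lost in [eta] and one in [dist] between consecutive levels. In
    [K ^+ 4], a square comes from these two ratios and one [K] from each part of Assumption A2.
    Assumption A2 is applied on V_H enlarged by the corrected function. Since this space contains
    that function, its distance to the direct solution is at most the correction error; since it
    contains V_H, its [eta] is at most that of V_H. The last comparison is between
    finite-dimensional subspaces, so the finite element spaces are shown to be such. *)

Section semi_inner_product.
Variables (R : realType) (V : lmodType R) (P : set V) (B : V -> V -> R).
Hypothesis P_lin : forall c v w, P v -> P w -> P (c *: v + w).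
Hypothesis B_sym : forall v w, B v w = B w v.
Hypothesis B_lin : forall c v w z, P v -> P w -> P z ->
  B (c *: v + w) z = c * B v z + B w z.
Hypothesis B_ge0 : forall v, P v -> 0 <= B v v.

Lemma semi_inner_expand c v w : P v -> P w ->
  B (c *: v + w) (c *: v + w) = c ^+ 2 * B v v + 2 * c * B v w + B w w.
Proof.
move=> Pv Pw; have Pz := P_lin c Pv Pw.
rewrite B_lin // (B_sym v) (B_sym w) !B_lin // (B_sym w v); ring.
Qed.

(** The quadratic [B (c *: v + w) (c *: v + w)] in [c] is nonnegative, so its discriminant is not
    positive. As [B] may be degenerate, [B v v = 0] is a separate case. *)
Lemma semi_inner_cauchy_schwarz v w : P v -> P w ->
  `|B v w| <= Num.sqrt (B v v) * Num.sqrt (B w w).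
Proof.
move=> Pv Pw; rewrite -sqrtrM ?B_ge0 // -sqrtr_sqr ler_wsqrtr //.
have q c : 0 <= c ^+ 2 * B v v + 2 * c * B v w + B w w.
  by rewrite -semi_inner_expand // B_ge0 //; exact: P_lin.
have := B_ge0 Pv; rewrite le_eqVlt => /predU1P[v0|v_gt0].
  rewrite -v0 mul0r; have [->|b0] := eqVneq (B v w) 0; first by rewrite expr0n.
  (* With [B v v = 0] the quadratic is affine, and at this [c] it equals -1. *)
  have := q (- (B w w + 1) / (2 * B v w)).
  rewrite -v0 mulr0 add0r.
  have -> : 2 * (- (B w w + 1) / (2 * B v w)) * B v w = - (B w w + 1) by field.
  nra.
(* The minimiser of the quadratic. *)
have := q (- B v w / B v v).
have -> : (- B v w / B v v) ^+ 2 * B v v + 2 * (- B v w / B v v) * B v w + B w w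
  = (B v v * B w w - B v w ^+ 2) / B v v by field; rewrite gt_eqF.
by rewrite pmulr_lge0 ?invr_gt0 // subr_ge0.
Qed.

Lemma semi_inner_triangle v w : P v -> P w ->
  Num.sqrt (B (v + w) (v + w)) <= Num.sqrt (B v v) + Num.sqrt (B w w).
Proof.
move=> Pv Pw; have := semi_inner_expand 1 Pv Pw.
rewrite scale1r => ->; rewrite -[leRHS]ger0_norm ?addr_ge0 ?sqrtr_ge0 //.
rewrite -[leRHS]sqrtr_sqr ler_wsqrtr // sqrrD !sqr_sqrtr ?B_ge0 //.
have := semi_inner_cauchy_schwarz Pv Pw; have := ler_norm (B v w).
rewrite -mulr_natr; lra.
Qed.

Lemma semi_inner_scale c v : P v -> P 0 ->
  Num.sqrt (B (c *: v) (c *: v)) = `|c| * Num.sqrt (B v v).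
Proof.
move=> Pv P0; rewrite -[c *: v]addr0 semi_inner_expand //.
have B0 z : P z -> B 0 z = 0.
  by move=> Pz; have := B_lin 1 P0 P0 Pz; rewrite scaler0 add0r; lra.
by rewrite (B_sym v) !B0 // mulr0 !addr0 sqrtrM ?sqr_ge0 // sqrtr_sqr.
Qed.

End semi_inner_product.

(** * Lebesgue measure on row vectors and square integrability *)

Section lebesgue_rV.
Variable R : realType.

Lemma measurable_coor_box n (F : 'I_n -> set R) : (forall i, measurable (F i)) ->
  measurable [set x : 'rV[R]_n | forall i, F i (x 0 i)].
Proof.
move=> mF; rewrite (_ : [set _ | _] =
    \bigcap_(i in [set: 'I_n]) ((fun x : 'rV[R]_n => x 0 i) @^-1` F i)).
  apply: fin_bigcap_measurable => // i _.
  by rewrite -[X in measurable X]setTI; exact: measurable_coor.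
by apply/seteqP; split => x /= Fx i; move=> *; exact: Fx.
Qed.

(** The sigma-algebra is generated by the coordinates, not by the topology. An open set is the
    countable union of the boxes with rational centre and radius [1/(k+1)] that it contains; [F]
    enumerates them through [unpickle]. *)
Lemma open_measurable_rV n (A : set 'rV[R]_n) : open A -> measurable A.
Proof.
move=> oA.
pose box (p : 'rV[rat]_n * nat) : set 'rV[R]_n :=
  [set x | forall i, ball (ratr (p.1 0 i) : R) p.2.+1%:R^-1 (x 0 i)].
pose F k := if unpickle k is Some p then
  (if `[< box p `<=` A >] then box p else set0) else set0.
have -> : A = \bigcup_k F k.
  apply/seteqP; split => [x Ax|x [k _]]; last first.
    rewrite /F; case: unpickle => // p; case: ifPn => // /asboolP; exact.
  have : nbhs x A by exact: open_nbhs_nbhs.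
  move=> /nbhs_ballP[e /= e0 xeA].
  (* A box of this radius whose centre is within the radius of [x] contains [x], and all its points
     are at distance less than [e] from [x]. *)
  have [k ke] : exists k : nat, 2 * k.+1%:R^-1 < e.
    have : (0 : R) < e / 2 by rewrite divr_gt0.
    move=> /ltr_add_invr[k]; rewrite add0r => ke.
    by exists k; rewrite mulrC -ltr_pdivlMr.
  have /choice[q hq] : forall i, exists r : rat, `|x 0 i - ratr r| < k.+1%:R^-1.
    move=> i; have : x 0 i - k.+1%:R^-1 < x 0 i + k.+1%:R^-1.
      by rewrite ltrBlDr -addrA ltrDl addr_gt0 ?invr_gt0.
    move=> /rat_in_itvoo[r]; rewrite in_itv /= => /andP[r1 r2].
    by exists r; rewrite distrC ltr_distl r1 r2.
  pose p : 'rV[rat]_n * nat := (\row_i q i, k).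
  have boxp z i : box p z -> `|ratr (q i) - z 0 i| < k.+1%:R^-1.
    by move=> /(_ i); rewrite /ball /= mxE.
  exists (pickle p) => //; rewrite /F pickleK ifT.
    by move=> i; rewrite /ball /= mxE distrC.
  apply/asboolP => z pz; apply: xeA; split => // i j.
  rewrite (ord1 i) /ball /=; have := boxp _ j pz; have := hq j.
  rewrite (_ : x 0 j - z 0 j = (x 0 j - ratr (q j)) + (ratr (q j) - z 0 j)); last by ring.
  move=> h1 h2; apply: le_lt_trans (ler_normD _ _) (lt_trans _ ke).
  by rewrite mulr2n mulrDl mul1r ltrD.
apply: bigcupT_measurable => k; rewrite /F; case: unpickle => // p; case: ifP => // _.
apply: (@measurable_coor_box n (fun i => ball (ratr (p.1 0 i) : R) p.2.+1%:R^-1)) => i.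
exact: measurable_ball.
Qed.

Lemma consr0 n (p : R * 'rV[R]_n) : consr p 0 ord0 = p.1.
Proof. by have /(congr1 fst) := consrK p. Qed.

Lemma consr_lift n (p : R * 'rV[R]_n) i : consr p 0 (lift ord0 i) = p.2 0 i.
Proof. by have /(congr1 snd)/rowP/(_ i) := consrK p; rewrite mxE. Qed.

Definition cube n (L : R) : set 'rV[R]_n := [set x | forall i, `[- L, L]%classic (x 0 i)].

Lemma measurable_cube n L : measurable (@cube n L).
Proof. exact: (@measurable_coor_box n (fun=> `[- L, L]%classic)). Qed.

(** By induction along R^(n+1) = R x R^n: the cube splits into a segment times a cube. *)
Lemma leb_cube_lty n L : (leb R n (@cube n L) < +oo)%E.
Proof.
elim: n => [|n IH]; first by rewrite /= diracE ltry.
rewrite /= /cons_measure /pushforward.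
have -> : @consr R n @^-1` cube L = `[- L, L]%classic `*` cube L.
  apply/seteqP; split => -[t y] /=.
    move=> h; split; first by have := h ord0; rewrite consr0.
    by move=> i; have := h (lift ord0 i); rewrite consr_lift.
  move=> [h1 h2] i; case: (unliftP ord0 i) => [j ->|->].
    by rewrite consr_lift; exact: h2.
  by rewrite consr0.
rewrite product_measure1E //; last exact: measurable_cube.
rewrite lte_mul_pinfty //.
suff : @lebesgue_measure R `[- L, L]%classic \is a fin_num by [].
by rewrite lebesgue_measure_itv /=; case: ifP.
Qed.

Lemma bounded_cube n (A : set 'rV[R]_n) : bounded_set A ->
  exists2 L, 0 < L & A `<=` cube L.
Proof.
move=> [M [_ hM]]; exists (`|M| + 1); first by rewrite ltr_wpDl.
move=> x Ax i /=; rewrite in_itv /= -ler_norml.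
have := hM (`|M| + 1); rewrite (le_lt_trans (ler_norm M)) ?ltrDl // => /(_ isT x Ax).
apply: le_trans; rewrite [leRHS]mx_normrE.
by have := le_bigmax 0 (fun ij : 'I_1 * 'I_n => `|x ij.1 ij.2|) (0, i).
Qed.

Lemma leb_bounded_lty n (A : set 'rV[R]_n) : measurable A -> bounded_set A ->
  (leb R n A < +oo)%E.
Proof.
move=> mA /bounded_cube[L _ AL]; apply: le_lt_trans (leb_cube_lty n L).
by apply: le_measure => //; rewrite inE //; exact: measurable_cube.
Qed.

End lebesgue_rV.

(** * Square-integrable functions *)

Section L2.
Variables (R : realType) (d : nat) (Om : set 'rV[R]_d).
Hypothesis mOm : measurable Om.
Notation pt := 'rV[R]_d.
Implicit Types g h k : pt -> R.

(** The product is dominated by [g ^+ 2 + h ^+ 2]. *)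
Lemma L2_mul_integrable g h : L2 Om g -> L2 Om h ->
  (leb R d).-integrable Om (fun x => (g x * h x)%:E).
Proof.
move=> [mg ig] [mh ih].
have igh := integrableD mOm ig ih.
apply: le_integrable igh => //.
  by apply/measurable_EFinP; exact: measurable_funM.
move=> x _ /=; rewrite lee_fin.
rewrite [leRHS]ger0_norm ?addr_ge0 ?sqr_ge0 // ler_norml.
have := sqr_ge0 (g x - h x); have := sqr_ge0 (g x + h x).
have := sqr_ge0 (g x); have := sqr_ge0 (h x).
rewrite !expr2; nra.
Qed.

Lemma L2_lin c g h : L2 Om g -> L2 Om h -> L2 Om (fun x => c * g x + h x).
Proof.
move=> Lg Lh; have [mg ig] := Lg; have [mh ih] := Lh.
have mgh : measurable_fun Om (fun x => c * g x + h x).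
  by apply: measurable_funD => //; apply: measurable_funM.
split => //.
have i1 := integrableZl mOm (2 * c ^+ 2) ig.
have i2 := integrableZl mOm 2 ih.
apply: le_integrable (integrableD mOm i1 i2) => //.
  by apply/measurable_EFinP; exact: measurable_funX.
move=> x _ /=; rewrite lee_fin !ger0_norm ?sqr_ge0 //.
  have := sqr_ge0 (c * g x - h x); rewrite !expr2; nra.
have := sqr_ge0 (c * g x); have := sqr_ge0 (h x); rewrite !expr2; nra.
Qed.

Lemma L20 : L2 Om (fun=> 0).
Proof.
split => //; rewrite (_ : (fun _ => _) = cst 0%E) //; first exact: integrable0.
by apply/funext => x; rewrite expr0n.
Qed.

Lemma ip_sym g h : ip Om g h = ip Om h g.
Proof. by apply: eq_Rintegral => x _; rewrite mulrC. Qed.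

Lemma ip_lin_integrable c g h k :
  (leb R d).-integrable Om (fun x => (g x * k x)%:E) ->
  (leb R d).-integrable Om (fun x => (h x * k x)%:E) ->
  ip Om (fun x => c * g x + h x) k = c * ip Om g k + ip Om h k.
Proof.
move=> ig ih; rewrite /ip -RintegralZl // -RintegralD //.
  by apply: eq_Rintegral => x _; ring.
rewrite (_ : _ \o _ = (fun x => c%:E * (g x * k x)%:E)%E) //.
  exact: integrableZl.
Qed.

Lemma ip_lin c g h k : L2 Om g -> L2 Om h -> L2 Om k ->
  ip Om (fun x => c * g x + h x) k = c * ip Om g k + ip Om h k.
Proof. by move=> *; apply: ip_lin_integrable; exact: L2_mul_integrable. Qed.

Lemma ip_ge0 g : 0 <= ip Om g g.
Proof. by apply: Rintegral_ge0 => x _; rewrite -expr2 sqr_ge0. Qed.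

End L2.

(** * The space [H01] *)

Section test_functions.
Variables (R : realType) (d : nat).
Notation pt := 'rV[R]_d.
Implicit Types g h : pt -> R.

Lemma continuous_measurable_rV g : continuous g -> measurable_fun [set: pt] g.
Proof.
move=> /continuousP cg; apply: (measurability _ (RGenOpens.measurableE R)).
move=> _ [_ [a [b ->] <-]]; rewrite setTI.
by apply: open_measurable_rV; exact/cg/interval_open.
Qed.

Lemma compact_support_bounded g (A : set pt) : continuous g -> compact A ->
  (forall x, ~ A x -> g x = 0) -> exists M, forall x, `|g x| <= M.
Proof.
move=> cg cA gA.
have := continuous_compact (continuous_subspaceT cg) cA.
move=> /compact_bounded[M [_ hM]]; exists (`|M| + 1) => x.
have M1 : M < `|M| + 1 by rewrite (le_lt_trans (ler_norm M)) ?ltrDl.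
have [Ax|nAx] := pselect (A x); first by apply: (hM _ M1); exists x.
by rewrite gA // normr0 addr_ge0.
Qed.

Lemma L2_bounded (Om : set pt) g M : open Om -> bounded_set Om ->
  continuous g -> (forall x, `|g x| <= M) -> L2 Om g.
Proof.
move=> oOm bOm cg gM.
have mOm := open_measurable_rV oOm.
have mg : measurable_fun Om g.
  by apply: measurable_funTS; exact: continuous_measurable_rV.
split => //; apply: measurable_bounded_integrable => //.
- exact: leb_bounded_lty.
- exact: measurable_funX.
- exists (M ^+ 2); split; first exact: num_real.
  move=> y My x _ /=; rewrite (le_trans _ (ltW My)) // ger0_norm ?sqr_ge0 //.
  rewrite -real_normK ?num_real // lerXn2r ?nnegrE //.
  exact: le_trans (gM x).
Qed.

Lemma partial_lin i c g h x :
  derivable g x (delta_mx 0 i) -> derivable h x (delta_mx 0 i) ->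
  partial i (fun y => c * g y + h y) x = c * partial i g x + partial i h x /\
  derivable (fun y => c * g y + h y) x (delta_mx 0 i).
Proof.
move=> dg dh; have dcg := @derivableZ _ _ _ g c _ _ dg.
have -> : (fun y => c * g y + h y) = c \*: g + h by [].
split; last exact: derivableD.
by rewrite /partial deriveD // deriveZ.
Qed.

Lemma foldr_partial_lin c g h s : smooth g -> smooth h ->
  foldr (@partial R d) (fun y => c * g y + h y) s =
  (fun y => c * foldr (@partial R d) g s y + foldr (@partial R d) h s y).
Proof.
move=> sg sh; elim: s => [//|i s IH] /=; rewrite IH; apply/funext => x.
by have [//] := @partial_lin i c _ _ x (proj2 (sg s) i x) (proj2 (sh s) i x).
Qed.

Lemma smooth_lin c g h : smooth g -> smooth h -> smooth (fun y => c * g y + h y).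
Proof.
move=> sg sh s; rewrite foldr_partial_lin //; split.
  by move=> x; apply: (cvgD (cvgM (cvg_cst c) (proj1 (sg s) x)) (proj1 (sh s) x)).
move=> i x.
by have [_] := @partial_lin i c _ _ x (proj2 (sg s) i x) (proj2 (sh s) i x).
Qed.

Lemma partial0 i : partial i (fun _ : pt => 0 : R) = fun=> 0.
Proof. by apply/funext => x; rewrite /partial derive_cst. Qed.

Lemma smooth0 : smooth (fun _ : pt => 0 : R).
Proof.
move=> s; rewrite (_ : foldr _ _ s = fun=> 0); last first.
  by elim: s => //= i s ->; rewrite partial0.
by split => [|i x]; [exact: cst_continuous|exact: derivable_cst].
Qed.

Variable Om : set pt.

Lemma test_function_lin c g h : test_function Om g -> test_function Om h ->
  test_function Om (fun y => c * g y + h y).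
Proof.
move=> [sg [A [cA AO gA]]] [sh [B [cB BO hB]]]; split; first exact: smooth_lin.
exists (A `|` B); split; [exact: compactU|by rewrite subUset|].
move=> x nAB; rewrite gA ?hB ?mulr0 ?addr0 //; first by move=> Bx; apply: nAB; right.
by move=> Ax; apply: nAB; left.
Qed.

Lemma test_function0 : test_function Om (fun=> 0).
Proof. by split; [exact: smooth0|exists set0; split => //; exact: compact0]. Qed.

(** As [A] is closed, [g] vanishes in a neighbourhood of each point outside it, so its derivative
    there is that of a constant. *)
Lemma partial_support i g (A : set pt) : compact A ->
  (forall x, ~ A x -> g x = 0) -> forall x, ~ A x -> partial i g x = 0.
Proof.
move=> cA gA x nAx.
have clA : closed A by apply: compact_closed => //; exact: norm_hausdorff.
rewrite /partial -(derive_cst (0 : R) x (delta_mx 0 i)); apply: near_eq_derive.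
have : nbhs x (~` A) by apply: open_nbhs_nbhs; split => //; exact: closed_openC.
by apply: filterS => y /gA.
Qed.

Lemma smooth_sob_lin c g h : smooth g -> smooth h ->
  smooth_sob (fun y => c * g y + h y) = c *: smooth_sob g + smooth_sob h.
Proof.
move=> sg sh; congr pair; apply/funext => x; apply/rowP => i; rewrite !mxE.
by have [->] := @partial_lin i c _ _ x (proj2 (sg [::]) i x) (proj2 (sh [::]) i x).
Qed.

End test_functions.

(** * Bilinear forms and norms on pairs *)

Section sobolev_forms.
Variables (R : realType) (d : nat) (Om : set 'rV[R]_d).
Hypothesis mOm : measurable Om.
Notation pt := 'rV[R]_d.
Implicit Types v w z : sob R d.

(** The integrability part of [H01], on which [ip] and [gip] are bilinear. It is isolated because
    the approximating test functions enter the same estimates as their limits. *)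
Definition L2sob v := L2 Om v.1 /\ forall i, L2 Om (fun x => v.2 x 0 i).

Lemma sob_lin1 c v w : (c *: v + w).1 = fun x => c * v.1 x + w.1 x.
Proof. by []. Qed.

Lemma sob_lin2 c v w i : (fun x => (c *: v + w).2 x 0 i) =
  fun x => c * v.2 x 0 i + w.2 x 0 i.
Proof. by apply/funext => x; rewrite !mxE. Qed.

Lemma L2sob_lin c v w : L2sob v -> L2sob w -> L2sob (c *: v + w).
Proof.
move=> [v1 v2] [w1 w2]; split; first exact: L2_lin.
by move=> i; rewrite sob_lin2; exact: L2_lin.
Qed.

Lemma L2sob0 : L2sob 0.
Proof.
split; first exact: L20.
by move=> i; rewrite (_ : (fun x => _) = fun=> 0); [exact: L20|apply/funext => x; rewrite mxE].
Qed.

Lemma dot_integrable v w : L2sob v -> L2sob w ->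
  (leb R d).-integrable Om (fun x => (dot (v.2 x) (w.2 x))%:E).
Proof.
move=> [_ v2] [_ w2].
have := @integrable_sum _ _ _ (leb R d) Om mOm 'I_d (index_enum 'I_d) xpredT
  (fun i x => (v.2 x 0 i * w.2 x 0 i)%:E) (fun i _ => L2_mul_integrable mOm (v2 i) (w2 i)).
by apply: eq_integrable => // x _; rewrite /= sumEFin.
Qed.

Lemma gip_sym v w : gip Om v w = gip Om w v.
Proof. by apply: eq_Rintegral => x _; apply: eq_bigr => i _; rewrite mulrC. Qed.

Lemma gip_lin c v w z : L2sob v -> L2sob w -> L2sob z ->
  gip Om (c *: v + w) z = c * gip Om v z + gip Om w z.
Proof.
move=> Lv Lw Lz; have iv := dot_integrable Lv Lz; have iw := dot_integrable Lw Lz.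
rewrite /gip -RintegralZl // -RintegralD //; last first.
  rewrite (_ : _ \o _ = (fun x => c%:E * (dot (v.2 x) (z.2 x))%:E)%E) //.
  exact: integrableZl.
apply: eq_Rintegral => x _; rewrite /dot mulr_sumr -big_split /=.
by apply: eq_bigr => i _; rewrite !mxE; ring.
Qed.

Lemma gip_ge0 v : 0 <= gip Om v v.
Proof.
by apply: Rintegral_ge0 => x _; apply: sumr_ge0 => i _; rewrite -expr2 sqr_ge0.
Qed.

Definition ip1 v w := ip Om v.1 w.1 + gip Om v w.

Lemma ip1_sym v w : ip1 v w = ip1 w v.
Proof. by rewrite /ip1 ip_sym gip_sym. Qed.

Lemma ip_sob_lin c v w z : L2sob v -> L2sob w -> L2sob z ->
  ip Om (c *: v + w).1 z.1 = c * ip Om v.1 z.1 + ip Om w.1 z.1.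
Proof. by move=> [v1 _] [w1 _] [z1 _]; exact: ip_lin. Qed.

Lemma ip1_lin c v w z : L2sob v -> L2sob w -> L2sob z ->
  ip1 (c *: v + w) z = c * ip1 v z + ip1 w z.
Proof. by move=> *; rewrite /ip1 ip_sob_lin // gip_lin //; ring. Qed.

Lemma ip1_ge0 v : 0 <= ip1 v v.
Proof. by rewrite addr_ge0 ?ip_ge0 ?gip_ge0. Qed.

Definition normgrad v := Num.sqrt (gip Om v v).

Lemma norm0_triangle v w : L2sob v -> L2sob w ->
  norm0 Om (v + w) <= norm0 Om v + norm0 Om w.
Proof.
move=> Lv Lw; apply: (@semi_inner_triangle R (sob R d) L2sob
  (fun v w => ip Om v.1 w.1)) => //.
- exact: L2sob_lin.
- by move=> *; exact: ip_sym.
- exact: ip_sob_lin.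
- by move=> *; exact: ip_ge0.
Qed.

Lemma normgrad_triangle v w : L2sob v -> L2sob w -> normgrad (v + w) <= normgrad v + normgrad w.
Proof.
move=> Lv Lw; apply: (@semi_inner_triangle R (sob R d) L2sob (gip Om)) => //.
- exact: L2sob_lin.
- exact: gip_sym.
- exact: gip_lin.
- by move=> *; exact: gip_ge0.
Qed.

Lemma norm1_triangle v w : L2sob v -> L2sob w ->
  norm1 Om (v + w) <= norm1 Om v + norm1 Om w.
Proof.
move=> Lv Lw; apply: (@semi_inner_triangle R (sob R d) L2sob ip1) => //.
- exact: L2sob_lin.
- exact: ip1_sym.
- exact: ip1_lin.
- by move=> *; exact: ip1_ge0.
Qed.

Lemma norm1_scale c v : L2sob v -> norm1 Om (c *: v) = `|c| * norm1 Om v.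
Proof.
move=> Lv; apply: (@semi_inner_scale R (sob R d) L2sob ip1) => //.
- exact: L2sob_lin.
- exact: ip1_sym.
- exact: ip1_lin.
- exact: L2sob0.
Qed.

Lemma norm0_scale c v : L2sob v -> norm0 Om (c *: v) = `|c| * norm0 Om v.
Proof.
move=> Lv; apply: (@semi_inner_scale R (sob R d) L2sob (fun v w => ip Om v.1 w.1)) => //.
- exact: L2sob_lin.
- by move=> *; exact: ip_sym.
- exact: ip_sob_lin.
- exact: L2sob0.
Qed.

Lemma norm0_ge0 v : 0 <= norm0 Om v. Proof. exact: sqrtr_ge0. Qed.
Lemma norm1_ge0 v : 0 <= norm1 Om v. Proof. exact: sqrtr_ge0. Qed.
Lemma normgrad_ge0 v : 0 <= normgrad v. Proof. exact: sqrtr_ge0. Qed.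

Lemma norm0_le_norm1 v : norm0 Om v <= norm1 Om v.
Proof. by rewrite ler_wsqrtr // lerDl gip_ge0. Qed.

Lemma normgrad_le_norm1 v : normgrad v <= norm1 Om v.
Proof. by rewrite ler_wsqrtr // lerDr ip_ge0. Qed.

Lemma norm1_le_sum v : norm1 Om v <= norm0 Om v + normgrad v.
Proof.
rewrite -[leRHS]ger0_norm ?addr_ge0 ?sqrtr_ge0 // -[leRHS]sqrtr_sqr ler_wsqrtr //.
rewrite sqrrD !sqr_sqrtr ?ip_ge0 ?gip_ge0 // lerD2r lerDl.
by rewrite mulrn_wge0 // mulr_ge0 ?sqrtr_ge0.
Qed.

Lemma ip_le_norm0 v w : L2sob v -> L2sob w -> `|ip Om v.1 w.1| <= norm0 Om v * norm0 Om w.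
Proof.
move=> Lv Lw; apply: (@semi_inner_cauchy_schwarz R (sob R d) L2sob
  (fun v w => ip Om v.1 w.1)) => //.
- exact: L2sob_lin.
- by move=> *; exact: ip_sym.
- exact: ip_sob_lin.
- by move=> *; exact: ip_ge0.
Qed.

Lemma H01_L2sob v : H01 Om v -> L2sob v. Proof. by case. Qed.

End sobolev_forms.

(** * [H01] is a linear subspace *)

Section H01_subspace.
Variables (R : realType) (d : nat) (Om : set 'rV[R]_d).
Hypotheses (oOm : open Om) (bOm : bounded_set Om).
Let mOm := open_measurable_rV oOm.

(** Compact support makes [g] and its partial derivatives bounded, and [Om] has finite measure. *)
Lemma test_function_L2sob g : test_function Om g -> L2sob Om (smooth_sob g).
Proof.
move=> [sg [A [cA AO gA]]]; split.
  have [cg _] := sg [::]; have [M gM] := compact_support_bounded cg cA gA.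
  exact: L2_bounded gM.
move=> i; have [cg _] := sg [:: i].
rewrite (_ : (fun x => _) = partial i g); last by apply/funext => x; rewrite mxE.
have [M gM] := compact_support_bounded cg cA (partial_support i cA gA).
exact: L2_bounded gM.
Qed.

(** The approximating sequences combine linearly, and the triangle inequality squeezes the [norm1]
    error to 0. *)
Lemma H01_lin c v w : H01 Om v -> H01 Om w -> H01 Om (c *: v + w).
Proof.
move=> Hv Hw; have [v1 v2 [phi [tphi cphi]]] := Hv; have [w1 w2 [psi [tpsi cpsi]]] := Hw.
have [L1 Lg] := L2sob_lin mOm c (H01_L2sob Hv) (H01_L2sob Hw).
split => //; exists (fun n x => c * phi n x + psi n x); split.
  by move=> n; exact: test_function_lin.
have lim0 : (`|c| * norm1 Om (smooth_sob (phi n) - v)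
    + norm1 Om (smooth_sob (psi n) - w)) @[n --> \oo] --> (0 : R).
  rewrite (_ : 0 = `|c| * 0 + 0 :> R); last by rewrite mulr0 addr0.
  by apply: cvgD; [apply: cvgM; [exact: cvg_cst|exact: cphi]|exact: cpsi].
apply: squeeze_cvgr (cvg_cst 0) lim0; near=> n.
rewrite norm1_ge0 /= smooth_sob_lin; [|exact: (tphi n).1|exact: (tpsi n).1].
have Lphi : L2sob Om (smooth_sob (phi n) - v).
  rewrite addrC -scaleN1r; apply: L2sob_lin => //; exact: test_function_L2sob.
have Lpsi : L2sob Om (smooth_sob (psi n) - w).
  rewrite addrC -scaleN1r; apply: L2sob_lin => //; exact: test_function_L2sob.
rewrite -norm1_scale // opprD addrACA -scalerBr; apply: norm1_triangle => //.
by rewrite -[c *: _]addr0; apply: L2sob_lin => //; exact: L2sob0.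
Unshelve. all: by end_near. Qed.

Lemma H010 : H01 Om 0.
Proof.
have [L1 Lg] := L2sob0 Om; split => //.
exists (fun=> (fun=> 0)); split => [n|]; first exact: test_function0.
have -> : (fun n : nat => norm1 Om (smooth_sob (fun=> 0) - 0)) = (fun=> 0).
  apply/funext => n; rewrite (_ : smooth_sob _ - 0 = 0 *: 0); last first.
    rewrite subr0 scaler0; congr pair; apply/funext => x; apply/rowP => i.
    by rewrite !mxE partial0.
  by rewrite norm1_scale ?normr0 ?mul0r //; exact: L2sob0.
exact: cvg_cst.
Qed.

Lemma subspaceH01 : Defs.subspace (H01 Om).
Proof. by split; [exact: H010|exact: H01_lin]. Qed.

End H01_subspace.

(** * The Poincare inequality *)

Section continuous_real_fun.
Variable R : realType.
Implicit Types f g : R -> R.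

Lemma continuous_add f g : continuous f -> continuous g ->
  continuous (fun t => f t + g t).
Proof. by move=> cf cg t; apply: cvgD; [exact: cf|exact: cg]. Qed.

Lemma continuous_mul f g : continuous f -> continuous g ->
  continuous (fun t => f t * g t).
Proof. by move=> cf cg t; apply: cvgM; [exact: cf|exact: cg]. Qed.

Lemma continuous_scale (c : R) f : continuous f -> continuous (fun t => c * f t).
Proof. by apply: continuous_mul; exact: cst_continuous. Qed.

Lemma continuous_sqr f : continuous f -> continuous (fun t => f t ^+ 2).
Proof. by move=> cf; apply: continuous_mul. Qed.

End continuous_real_fun.

Section poincare_line.
Variables (R : realType) (L : R) (g g' : R -> R).
Hypotheses (L_gt0 : 0 < L) (dg : forall t : R, is_derive t 1 g (g' t)).
Hypotheses (cg' : continuous g') (g0 : forall t : R, L <= `|t| -> g t = 0).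
Notation mu := (@lebesgue_measure R).

Let cg : continuous g.
Proof.
by move=> t; apply/differentiable_continuous/derivable1_diffP; have [] := dg t.
Qed.

Let int_cont (h : R -> R) : continuous h -> mu.-integrable `[- L, L] (EFin \o h).
Proof.
move=> ch; apply: continuous_compact_integrable; first exact: segment_compact.
exact: continuous_subspaceT.
Qed.

(* The derivative of t * g(t)^2 integrates to 0 over the support of g, and
   g^2 <= 2 (t g^2)' + 4 L^2 g'^2 on it. *)
Lemma poincare_segment : \int[mu]_(t in `[- L, L]) (g t ^+ 2) <=
  4 * L ^+ 2 * \int[mu]_(t in `[- L, L]) (g' t ^+ 2).
Proof.
pose h t := t * g t ^+ 2; pose h' t := g t ^+ 2 + t * (2 * g t * g' t).
have dh (t : R) : is_derive t 1 h (h' t).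
  rewrite (_ : h = id * g ^+ 2); last by apply/funext.
  by apply: is_derive_eq; rewrite /h' /= /GRing.scale /= expr1 mulr1 addrC.
have cid : continuous (fun t : R => t) by move=> t; exact: cvg_id.
have cg2 : continuous (fun t => g t ^+ 2).
  exact: continuous_sqr.
have cg'2 : continuous (fun t => g' t ^+ 2).
  exact: continuous_sqr.
have ch' : continuous h'.
  apply: continuous_add => //; apply: (@continuous_mul _ (fun t => t)) => //.
  by apply: continuous_mul => //; exact: continuous_scale.
have ch : continuous h by apply: (@continuous_mul _ (fun t => t)).
have LL : - L < L by rewrite gtrN.
have h0 : \int[mu]_(t in `[- L, L]) h' t = 0.
  rewrite /Rintegral (@continuous_FTC2 _ h' h) //.
  - by rewrite /h !g0 ?normrN ?ler_norm // expr0n !mulr0 /= subrr.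
  - exact: continuous_subspaceT.
  - split; last 2 first.
    + by apply: cvg_at_right_filter; exact: ch.
    + by apply: cvg_at_left_filter; exact: ch.
    by move=> t _; have [] := dh t.
  - by move=> t _; rewrite derive1E; have [] := dh t.
rewrite -RintegralZl //; last exact: int_cont.
(* Twice the vanishing integral of [h'] is added on the right, so that the inequality can be checked
   pointwise. *)
rewrite -[leRHS]add0r -[X in X + _](mulr0 2) -h0 -RintegralZl //; last exact: int_cont.
have ci (c : R) (k : R -> R) : continuous k ->
    mu.-integrable `[- L, L] (EFin \o (fun t => c * k t)).
  by move=> ck; apply: int_cont; exact: continuous_scale.
rewrite -RintegralD //; [|exact: ci|exact: ci].
apply: le_Rintegral => //; first exact: int_cont.
  by apply: int_cont; apply: continuous_add; exact: continuous_scale.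
move=> t /=; rewrite in_itv /= => /andP[t1 t2]; rewrite /h' -subr_ge0.
(* Completing the square; the other summand is nonnegative on the segment. *)
rewrite (_ : _ - _ = (g t + 2 * t * g' t) ^+ 2 + 4 * (L ^+ 2 - t ^+ 2) * g' t ^+ 2); last by ring.
rewrite addr_ge0 ?sqr_ge0 // mulr_ge0 ?sqr_ge0 // mulr_ge0 // subr_ge0 -(real_normK (num_real t)).
by apply: lerXn2r; rewrite ?nnegrE ?(ltW L_gt0) // ler_norml t1.
Qed.

(** The segment inequality in the form that Tonelli can integrate over the other coordinates: on the
    whole line, with extended real integrals. *)
Lemma poincare_line : (\int[mu]_t (g t ^+ 2)%:E <=
  (4 * L ^+ 2)%:E * \int[mu]_t (g' t ^+ 2)%:E)%E.
Proof.
have cg2 : continuous (fun t => g t ^+ 2).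
  exact: continuous_sqr.
have cg'2 : continuous (fun t => g' t ^+ 2).
  exact: continuous_sqr.
have -> : (\int[mu]_t (g t ^+ 2)%:E = \int[mu]_(t in `[(- L)%R, L]) (g t ^+ 2)%:E)%E.
  rewrite [RHS]integral_mkcond; apply: eq_integral => t _; rewrite patchE.
  case: ifPn => //; rewrite notin_setE /= in_itv /= -ler_norml => /negP.
  by rewrite -ltNge => /ltW /g0 ->; rewrite expr0n.
apply: (@le_trans _ _ ((4 * L ^+ 2)%:E * \int[mu]_(t in `[(- L)%R, L]) (g' t ^+ 2)%:E)%E).
  have := poincare_segment; rewrite -lee_fin EFinM /Rintegral !fineK //.
    by apply: integrable_fin_num => //; exact: int_cont.
  by apply: integrable_fin_num => //; exact: int_cont.
apply: lee_wpmul2l; first by rewrite lee_fin mulr_ge0 ?sqr_ge0.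
apply: ge0_subset_integral => //.
- by apply/measurable_EFinP; exact: continuous_measurable_fun.
- by move=> t _; rewrite lee_fin sqr_ge0.
Qed.

End poincare_line.

(** * Integration of the line inequality over the remaining coordinates *)

Section poincare_space.
Variables (R : realType) (k : nat).
Notation pt := 'rV[R]_k.+1.
Implicit Types F phi : pt -> R.

(** Identifies the difference quotients along a line with those of the first partial derivative. *)
Lemma consr_shift (h t : R) (y : 'rV[R]_k) :
  consr (h + t, y) = h *: delta_mx 0 ord0 + consr (t, y).
Proof.
apply/rowP => i; rewrite [RHS]mxE; case: (unliftP ord0 i) => [j ->|->].
  by rewrite !consr_lift !mxE /= mulr0 add0r.
by rewrite !consr0 !mxE !eqxx mulr1.
Qed.

Lemma continuous_consr F (y : 'rV[R]_k) : continuous F ->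
  continuous (fun t => F (consr (t, y))).
Proof.
move=> cF t; apply: continuous_comp; last exact: cF.
rewrite (_ : (fun t => consr (t, y)) =
    fun t : R => t *: (delta_mx 0 ord0 : pt) + consr (0, y)); last first.
  by apply/funext => s; rewrite -consr_shift addr0.
by apply: cvgD; [apply: cvgZ; [exact: cvg_id|exact: cvg_cst]|exact: cvg_cst].
Qed.

Lemma is_derive_consr F (y : 'rV[R]_k) (t : R) :
  derivable F (consr (t, y)) (delta_mx 0 ord0) ->
  is_derive t 1 (fun s => F (consr (s, y))) (partial ord0 F (consr (t, y))).
Proof.
have e : (fun h : R => h^-1 *: (F (consr (h *: 1 + t, y)) - F (consr (t, y)))) =
    (fun h : R => h^-1 *: (F (h *: (delta_mx 0 ord0 : pt) + consr (t, y)) - F (consr (t, y)))).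
  by apply/funext => h; rewrite -consr_shift /GRing.scale /= mulr1.
by rewrite /derivable => dF; apply: DeriveDef; rewrite /derivable /derive /partial /derive e.
Qed.

(** [leb R k.+1] is the image of a product measure under [consr]: a change of variables, then
    Tonelli. *)
Lemma leb_tonelli F : measurable_fun [set: pt] F -> (forall x, 0 <= F x) ->
  (\int[leb R k.+1]_x (F x)%:E =
   \int[leb R k]_y \int[@lebesgue_measure R]_t (F (consr (t, y)))%:E)%E.
Proof.
move=> mF F0; rewrite /= /cons_measure.
rewrite ge0_integral_pushforward //.
- rewrite preimage_setT fubini_tonelli2 //.
  + apply/measurable_EFinP; apply: measurableT_comp => //; exact: measurable_consr.
  + by move=> x; rewrite lee_fin.
- exact: measurable_consr.
- exact/measurable_EFinP.
- by move=> x _; rewrite lee_fin.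
Qed.

Lemma poincare_test_function L phi : smooth phi ->
  (forall x, ~ cube L x -> phi x = 0) -> 0 <= L ->
  (\int[leb R k.+1]_x (phi x ^+ 2)%:E <=
   (4 * (L + 1) ^+ 2)%:E * \int[leb R k.+1]_x (partial ord0 phi x ^+ 2)%:E)%E.
Proof.
move=> sphi phi0 L0.
have [cphi dphi] := sphi [::]; have [cdphi _] := sphi [:: ord0].
have mphi2 : measurable_fun [set: pt] (fun x => phi x ^+ 2).
  by apply: measurable_funX; exact: continuous_measurable_rV.
have mdphi2 : measurable_fun [set: pt] (fun x => partial ord0 phi x ^+ 2).
  by apply: measurable_funX; exact: continuous_measurable_rV.
have msec (F : pt -> R) : measurable_fun [set: pt] F -> (forall x, 0 <= F x) ->
    measurable_fun [set: 'rV[R]_k]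
      (fun y => \int[@lebesgue_measure R]_t (F (consr (t, y)))%:E)%E.
  move=> mF F0; apply: (@measurable_fun_fubini_tonelli_G _ _ _ _ R
    (@lebesgue_measure R) (fun p => (F (consr p))%:E)).
    by apply/measurable_EFinP; apply: measurableT_comp => //; exact: measurable_consr.
  by move=> x; rewrite lee_fin.
have sq0 (F : pt -> R) x : 0 <= F x ^+ 2 by rewrite sqr_ge0.
rewrite !leb_tonelli //.
rewrite -ge0_integralZl //.
- apply: ge0_le_integral => //.
  + by move=> y _; apply: integral_ge0 => t _; rewrite lee_fin sqr_ge0.
  + exact: (msec (fun x => phi x ^+ 2)).
  + apply: measurable_funeM; exact: (msec (fun x => partial ord0 phi x ^+ 2)).
  (* [L + 1] rather than [L]: the line inequality wants a positive bound and zeros from that bound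
     on, itself included, while [phi] is known to vanish only strictly outside the closed cube. *)
  + move=> y _; apply: (@poincare_line R (L + 1) (fun t => phi (consr (t, y)))
      (fun t => partial ord0 phi (consr (t, y)))).
    * by rewrite ltr_wpDl.
    * by move=> t; apply: is_derive_consr; exact: dphi.
    * exact: continuous_consr.
    * move=> t Lt; apply: phi0 => /(_ ord0); rewrite consr0 /= in_itv /= -ler_norml.
      by move=> /(le_trans Lt); rewrite gerDl ler10.
- exact: (msec (fun x => partial ord0 phi x ^+ 2)).
- by move=> y _; apply: integral_ge0 => t _; rewrite lee_fin sqr_ge0.
- by rewrite lee_fin mulr_ge0 ?sqr_ge0.
Qed.

End poincare_space.

(** * Extension to [H01] by density *)

Section poincare.
Variables (R : realType) (k : nat) (Om : set 'rV[R]_k.+1).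
Hypotheses (oOm : open Om) (bOm : bounded_set Om).
Let mOm := open_measurable_rV oOm.

Lemma integral_support (F : 'rV[R]_k.+1 -> R) : (forall x, ~ Om x -> F x = 0) ->
  (\int[leb R k.+1]_x (F x ^+ 2)%:E = \int[leb R k.+1]_(x in Om) (F x ^+ 2)%:E)%E.
Proof.
move=> F0; rewrite [RHS]integral_mkcond; apply: eq_integral => x _.
by rewrite patchE; case: ifPn => //; rewrite notin_setE => /F0 ->; rewrite expr0n.
Qed.

(** For test functions the integrals over the whole space reduce to [Om], and the first partial
    derivative is bounded by the gradient. Both sides are continuous in [norm1], which gives the
    rest. *)
Lemma poincare : exists2 C, 0 < C & forall v, H01 Om v -> norm1 Om v <= C * normgrad Om v.
Proof.
have [L L0 OmL] := bounded_cube bOm.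
pose C0 := 2 * (L + 1).
have C0_ge0 : 0 <= C0 by rewrite mulr_ge0 // addr_ge0 // ltW.
have C02 : 4 * (L + 1) ^+ 2 = C0 ^+ 2 by rewrite /C0; ring.
have test phi : test_function Om phi ->
    norm0 Om (smooth_sob phi) <= C0 * normgrad Om (smooth_sob phi).
  move=> tphi; have [L1 Lg] := test_function_L2sob oOm bOm tphi.
  have [sphi [A [cA AO phi0]]] := tphi.
  have out x : ~ Om x -> ~ A x by move=> nO /AO.
  have := poincare_test_function sphi _ (ltW L0).
  rewrite C02 !integral_support; last 2 first.
  - by move=> x /out /(partial_support ord0 cA phi0).
  - by move=> x /out /phi0.
  move=> /(_ (fun x nc => phi0 x (fun Ax => nc (OmL _ (AO _ Ax))))).
  have Ld : L2 Om (partial ord0 phi).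
    rewrite (_ : partial ord0 phi = fun x => (smooth_sob phi).2 x 0 ord0) //.
    by apply/funext => x; rewrite mxE.
  have [_ i1] := L1; have [_ i2] := Ld.
  move=> le_int.
  have le_ip : ip Om phi phi <= C0 ^+ 2 * ip Om (partial ord0 phi) (partial ord0 phi).
    rewrite /ip /Rintegral -lee_fin EFinM !fineK //.
    - exact: integrable_fin_num.
    - exact: integrable_fin_num.
  have le_gip : ip Om (partial ord0 phi) (partial ord0 phi)
      <= gip Om (smooth_sob phi) (smooth_sob phi).
    apply: le_Rintegral => //.
      exact: dot_integrable (test_function_L2sob oOm bOm tphi) (test_function_L2sob oOm bOm tphi).
    move=> x _; rewrite /dot (bigD1 ord0) //= mxE lerDl.
    by apply: sumr_ge0 => i _; rewrite -expr2 sqr_ge0.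
  rewrite /norm0 /normgrad -[C0]ger0_norm // -sqrtr_sqr -sqrtrM ?sqr_ge0 //.
  rewrite ler_wsqrtr // (le_trans le_ip) // ler_wpM2l ?sqr_ge0 //.
(* [C0] bounds [norm0]; the gradient part of [norm1] adds 1. *)
exists (C0 + 1); first by rewrite ltr_wpDl.
move=> v Hv; have [_ _ [phi [tphi cphi]]] := Hv.
suff n0 : norm0 Om v <= C0 * normgrad Om v.
  by rewrite (le_trans (norm1_le_sum Om v)) // mulrDl mul1r lerD2r.
have Lv := H01_L2sob Hv.
(* Two triangle inequalities, one for [norm0] and one for [normgrad], around the estimate for
   [phi n]; the last term tends to 0. *)
have bound n : norm0 Om v <=
    C0 * normgrad Om v + (C0 + 1) * norm1 Om (smooth_sob (phi n) - v).
  have Lp := test_function_L2sob oOm bOm (tphi n).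
  set w := smooth_sob (phi n) - v.
  have Lw : L2sob Om w by rewrite /w addrC -scaleN1r; exact: L2sob_lin.
  have LNw : L2sob Om (- w).
    by rewrite -scaleN1r -[_ *: _]addr0; apply: L2sob_lin => //; exact: L2sob0.
  have ev : smooth_sob (phi n) - w = v by rewrite /w opprB addrCA subrr addr0.
  have ew : v + w = smooth_sob (phi n) by rewrite /w addrCA subrr addr0.
  have := norm0_triangle mOm Lp LNw; rewrite ev.
  have := normgrad_triangle mOm Lv Lw; rewrite ew.
  have := test _ (tphi n).
  rewrite -(scaleN1r w) norm0_scale // normrN1 mul1r.
  have := norm0_le_norm1 Om w; have := normgrad_le_norm1 Om w.
  nra.
have lim : (C0 * normgrad Om v + (C0 + 1) * norm1 Om (smooth_sob (phi n) - v))
    @[n --> \oo] --> C0 * normgrad Om v.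
  rewrite -[X in _ --> X]addr0 -[X in _ --> _ + X](mulr0 (C0 + 1)).
  by apply: cvgD; [exact: cvg_cst|apply: cvgM => //; exact: cvg_cst].
rewrite -(cvg_lim _ lim) //; apply: limr_ge; first by apply/cvg_ex; eexists; exact: lim.
by near=> n; exact: bound.
Unshelve. all: by end_near. Qed.

End poincare.

(** * Finite element spaces *)

(** A free family in [S] of maximal length spans [S], since any vector outside its span would extend
    it. Lengths are bounded by the dimension of [V]. *)
Lemma subspace_spanning_family (K : fieldType) (V : vectType K) (S : set V) :
  S 0 -> (forall c v w, S v -> S w -> S (c *: v + w)) ->
  exists n (e : 'I_n -> V), (forall i, S (e i)) /\
    forall v, S v -> exists c : 'I_n -> K, v = \sum_i c i *: e i.
Proof.
move=> S0 Slin.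
pose P k := `[< exists X : k.-tuple V, free X /\ forall i, S X`_i >].
have exP : exists k, P k.
  exists 0%N; apply/asboolP; exists [tuple]; split; first exact: nil_free.
  by move=> i; rewrite nth_nil.
have ubP k : P k -> (k <= \dim {:V})%N.
  move=> /asboolP[X [/eqP fX _]]; rewrite -[leqLHS](size_tuple X) -fX dimvS //.
  exact: subvf.
case: (ex_maxnP exP ubP) => k /asboolP[X [fX SX]] kmax.
exists k, (fun i => X`_i); split => // v Sv; exists (fun i => coord X i v).
apply: coord_span; apply: contrapT => /negP nv.
suff /kmax : P k.+1 by rewrite ltnn.
apply/asboolP; exists (cons_tuple v X); split; first by rewrite /= free_cons nv.
by case.
Qed.

Section finite_elements.
Variables (R : realType) (d : nat) (Om : set 'rV[R]_d).
Hypotheses (oOm : open Om) (bOm : bounded_set Om).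
Let mOm := open_measurable_rV oOm.
Notation pt := 'rV[R]_d.

Lemma dot_lin c (p q x : pt) : dot (c *: p + q) x = c * dot p x + dot q x.
Proof.
rewrite /dot mulr_sumr -big_split /=; apply: eq_bigr => i _.
by rewrite !mxE mulrDl mulrA.
Qed.

Variable T : mesh R d.
Notation data := ('cV[R]_(nelem T) * 'M[R]_(nelem T, d))%type.

(* z collects the constants c and the gradients p of [fespace]. *)
Definition fe_data (z : data) (v : sob R d) : Prop :=
  H01 Om v /\ exists w : pt -> R,
    [/\ {within closure Om, continuous w},
        forall x, closure Om x -> ~ Om x -> w x = 0,
        forall i x, hull (elem i) x -> w x = z.1 i 0 + dot (row i z.2) x,
        {ae leb R d, forall x, Om x -> v.1 x = w x} &
        forall i, {ae leb R d, forall x, Om x -> hull (elem i) x -> v.2 x = row i z.2}].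

Lemma fe_dataE v : fespace Om T v <-> exists z, fe_data z v.
Proof.
split=> [[Hv [w [c [p [h1 h2 h3 h4 h5]]]]]|[z [Hv [w [h1 h2 h3 h4 h5]]]]].
  exists (\col_i c i, \matrix_i p i); split => //; exists w; split => //.
    by move=> i x hx; rewrite mxE rowK; exact: h3.
  by move=> i; have := h5 i; apply: filterS => x hx; rewrite rowK.
split => //; exists w, (fun i => z.1 i 0), (fun i => row i z.2); split => //.
Qed.

Lemma fe_data_lin c y z v w : fe_data y v -> fe_data z w ->
  fe_data (c *: y + z) (c *: v + w).
Proof.
move=> [Hv [f [f1 f2 f3 f4 f5]]] [Hw [g [g1 g2 g3 g4 g5]]].
split; first exact: H01_lin.
exists (fun x => c * f x + g x); split.
- move=> x; apply: cvgD; last exact: g1.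
  by apply: cvgM; [exact: cvg_cst|exact: f1].
- by move=> x Ox nOx; rewrite f2 // g2 // mulr0 addr0.
- move=> i x hx; rewrite (f3 i) // (g3 i) // !mxE linearP dot_lin; ring.
- by apply: filterS2 f4 g4 => x hf hg Ox; rewrite sob_lin1 hf // hg.
- move=> i; apply: filterS2 (f5 i) (g5 i) => x hf hg Ox hx.
  have -> : row i (c *: y + z).2 = c *: row i y.2 + row i z.2 by rewrite -linearP.
  by rewrite -hf // -hg.
Qed.

Lemma fe_data0 : fe_data 0 0.
Proof.
split; first exact: H010; exists (fun=> 0); split => //.
- by move=> x; exact: cvg_cst.
- by move=> i x _; rewrite mxE linear0 /dot big1 ?addr0 // => j _; rewrite mxE mul0r.
- exact: nearW.
- by move=> i; apply: nearW => x _ _; rewrite [RHS]row0.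
Qed.

Lemma fe_data_sum n (c : 'I_n -> R) (z : 'I_n -> data) (v : 'I_n -> sob R d) :
  (forall i, fe_data (z i) (v i)) ->
  fe_data (\sum_i c i *: z i) (\sum_i c i *: v i).
Proof.
move=> zv; apply: (big_ind2 fe_data); first exact: fe_data0.
- by move=> y v' z' w hy hz; have := fe_data_lin 1 hy hz; rewrite !scale1r.
- by move=> i _; have := fe_data_lin (c i) (zv i) fe_data0; rewrite !addr0.
Qed.

Lemma fespace_H01 : fespace Om T `<=` H01 Om.
Proof. by move=> v []. Qed.

Lemma subspace_fespace : Defs.subspace (fespace Om T).
Proof.
split; first by apply/fe_dataE; exists 0; exact: fe_data0.
move=> c v w /fe_dataE[y hy] /fe_dataE[z hz]; apply/fe_dataE.
by exists (c *: y + z); exact: fe_data_lin.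
Qed.

Hypothesis triT : triangulation Om T.

Lemma ae0_Rintegral (F : pt -> R) : measurable_fun Om F ->
  {ae leb R d, forall x, Om x -> F x = 0} -> \int[leb R d]_(x in Om) F x = 0.
Proof.
move=> mF F0; rewrite /Rintegral (ae_eq_integral (cst 0%E)) //.
- by rewrite integral0.
- exact/measurable_EFinP.
- by apply: filterS F0 => x h Ox /=; rewrite h.
Qed.

(** The elements cover [Om], so zero data force function and gradient to vanish almost everywhere;
    the pair [v] itself may still be nonzero. *)
Lemma fe_data0_norm1 v : fe_data 0 v -> norm1 Om v = 0.
Proof.
move=> [Hv [w [_ _ w_hull vw vg]]]; have [L1 Lg] := H01_L2sob Hv.
have cover x : Om x -> exists i : 'I_(nelem T), hull (elem i) x.
  have [_ ccl _] := triT; move=> /(@subset_closure _ Om); rewrite -ccl => -[i _ hi].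
  by exists i.
have w0 x : Om x -> w x = 0.
  move=> /cover[i hi]; rewrite (w_hull i) //= mxE linear0 /dot big1 ?addr0 // => j _.
  by rewrite mxE mul0r.
have g0 : {ae leb R d, forall x, Om x -> v.2 x = 0}.
  apply: filterS (filter_forall _ vg) => x h Ox.
  by have [i hi] := cover _ Ox; rewrite (h i Ox hi) linear0.
rewrite /norm1 /ip /gip !ae0_Rintegral ?addr0 ?sqrtr0 //.
- by have /measurable_int/measurable_EFinP := dot_integrable mOm (H01_L2sob Hv) (H01_L2sob Hv).
- apply: filterS g0 => x h Ox; rewrite h // /dot big1 // => i _; rewrite mxE mul0r //.
- by have [m1 _] := L1; exact: measurable_funM.
- by apply: filterS vw => x h Ox; rewrite h // w0 // mul0r.
Qed.

(** The attainable data form a subspace of a finite-dimensional space. Functions realising a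
    spanning family of data span [fespace], because equal data leave a difference of [norm1]
    zero. *)
Lemma finite_dim_fespace : finite_dim Om (fespace Om T).
Proof.
have [||n [e [eS e_span]]] := @subspace_spanning_family R data
    [set z | exists v, fe_data z v].
- by exists 0; exact: fe_data0.
- by move=> c y z [v hv] [w hw]; exists (c *: v + w); exact: fe_data_lin.
have /choice[v ev] := eS.
exists n, v; split; first by move=> i; apply/fe_dataE; exists (e i).
move=> w /fe_dataE[z hz]; have [c zc] := e_span z (ex_intro _ w hz).
exists c; apply: fe_data0_norm1.
have := fe_data_lin (-1) (fe_data_sum c ev) hz.
by rewrite -zc !scaleN1r addNr addrC.
Qed.

Lemma fd_subspace_fespace : fd_subspace Om (fespace Om T).
Proof.
split; [exact: subspace_fespace|exact: fespace_H01|exact: finite_dim_fespace].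
Qed.

End finite_elements.

(** * Enlarged subspaces and distances *)

Section subspaces.
Variables (R : realType) (d : nat) (Om : set 'rV[R]_d).
Hypotheses (oOm : open Om) (bOm : bounded_set Om).
Let mOm := open_measurable_rV oOm.
Implicit Types W : set (sob R d).

Lemma subspaceB W v w : Defs.subspace W -> W v -> W w -> W (v - w).
Proof. by move=> [_ Wl] Wv Ww; rewrite -scaleN1r addrC; exact: Wl. Qed.

Lemma subspaceD W v w : Defs.subspace W -> W v -> W w -> W (v + w).
Proof. by move=> [_ Wl] Wv Ww; rewrite -[v]scale1r; exact: Wl. Qed.

Lemma subspace_add_span W w : Defs.subspace W -> Defs.subspace (add_span W w).
Proof.
move=> [W0 Wl]; split; first by exists 0, 0; rewrite scale0r addr0.
move=> c _ _ [v1 [a1 [h1 ->]]] [v2 [a2 [h2 ->]]].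
exists (c *: v1 + v2), (c * a1 + a2); split; first exact: Wl.
by rewrite scalerDr scalerA scalerDl addrACA.
Qed.

Lemma add_span_sub W W' w : Defs.subspace W' -> W `<=` W' -> W' w ->
  add_span W w `<=` W'.
Proof.
by move=> [_ Wl] WW' Ww _ [v [a [hv ->]]]; rewrite addrC; apply: Wl => //; exact: WW'.
Qed.

Lemma fd_subspace_add_span W w : fd_subspace Om W -> H01 Om w ->
  fd_subspace Om (add_span W w).
Proof.
move=> [sW WH [n [e [eW e_span]]]] Hw; split.
- exact: subspace_add_span.
- exact: (add_span_sub (subspaceH01 oOm bOm) WH Hw).
(* Index 0 carries the new vector [w], the lifted indices the old family. *)
exists n.+1, (fun i => if unlift ord0 i is Some j then e j else w); split.
  move=> i; case: unlift => [j|].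
    by exists (e j), 0; rewrite scale0r addr0.
  by exists 0, 1; rewrite scale1r add0r; split => //; case: sW.
move=> _ [v [a [Wv ->]]]; have [c cv] := e_span v Wv.
exists (fun i => if unlift ord0 i is Some j then c j else a).
rewrite big_ord_recl unlift_none; under eq_bigr do rewrite liftK.
by rewrite [v + _]addrC opprD addrACA subrr add0r.
Qed.

Lemma dist_lbound W w : has_lbound [set norm1 Om (w - v) | v in W].
Proof. by exists 0 => _ [v _ <-]; exact: norm1_ge0. Qed.

Lemma dist_le W w v : W v -> Defs.dist Om W w <= norm1 Om (w - v).
Proof. by move=> Wv; apply: ge_inf; [exact: dist_lbound|exists v]. Qed.

Lemma dist_ge0 W w : Defs.subspace W -> 0 <= Defs.dist Om W w.
Proof.
move=> [W0 _]; apply: lb_le_inf; first by exists (norm1 Om (w - 0)), 0.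
by move=> _ [v _ <-]; exact: norm1_ge0.
Qed.

Lemma dist_anti W W' w : Defs.subspace W -> W `<=` W' ->
  Defs.dist Om W' w <= Defs.dist Om W w.
Proof.
move=> [W0 _] WW'; apply: lb_le_inf; first by exists (norm1 Om (w - 0)), 0.
by move=> _ [v Wv <-]; apply: dist_le; exact: WW'.
Qed.

End subspaces.

(** * Errors of the two correction steps *)

Section correction.
Variables (R : realType) (k : nat) (Om : set 'rV[R]_k.+1) (f : 'rV[R]_k.+1 -> R -> R).
Hypotheses (oOm : open Om) (bOm : bounded_set Om) (hf : smooth_nonlinearity Om f).
Let mOm := open_measurable_rV oOm.
Notation fw w := (fun x => f x (w.1 x)).
Implicit Types v w : sob R k.+1.

Lemma a_form_split w v : H01 Om w -> H01 Om v ->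
  a_form Om f w v = gip Om w v + ip Om (fw w) v.1.
Proof.
move=> Hw Hv; have [_ _ _ intf] := hf.
rewrite /a_form /gip /ip -RintegralD //; last exact: intf.
exact: dot_integrable (H01_L2sob Hw) (H01_L2sob Hv).
Qed.

(** For [f x (w.1 x)] only the products with elements of [H01] are known to be integrable, so the
    assumption is on products rather than on square-integrable factors. The first conclusion allows
    iteration. *)
Lemma ipB_integrable (g h z : 'rV[R]_k.+1 -> R) :
  (leb R k.+1).-integrable Om (fun x => (g x * z x)%:E) ->
  (leb R k.+1).-integrable Om (fun x => (h x * z x)%:E) ->
  (leb R k.+1).-integrable Om (fun x => ((g x - h x) * z x)%:E) /\
  ip Om (fun x => g x - h x) z = ip Om g z - ip Om h z.
Proof.
move=> ig ih; split.
  have := integrableB mOm ig ih; apply: eq_integrable => // x _.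
  by rewrite /= mulrBl.
by rewrite /ip -RintegralB //; apply: eq_Rintegral => x _; rewrite mulrBl.
Qed.

Lemma gipB v w z : L2sob Om v -> L2sob Om w -> L2sob Om z ->
  gip Om (v - w) z = gip Om v z - gip Om w z.
Proof.
move=> Lv Lw Lz; rewrite -scaleN1r addrC gip_lin //; ring.
Qed.

(** The difference splits as [l * b_form (x - y) v + (l - mu) * b_form y v]; Cauchy-Schwarz bounds
    both terms. *)
Lemma b_form_residual l mu x y v : L2sob Om x -> L2sob Om y -> L2sob Om v ->
  norm0 Om y = 1 ->
  `|l * b_form Om x v - mu * b_form Om y v| <=
    (`|l| * norm0 Om (x - y) + `|l - mu|) * norm1 Om v.
Proof.
move=> Lx Ly Lv y1.
have Lxy : L2sob Om (x - y) by rewrite -scaleN1r addrC; exact: L2sob_lin.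
have ebxy : b_form Om (x - y) v = b_form Om x v - b_form Om y v.
  by rewrite -scaleN1r addrC /b_form; have := ip_sob_lin mOm (-1) Ly Lx Lv; rewrite /ip => ->; ring.
have -> : l * b_form Om x v - mu * b_form Om y v =
    l * b_form Om (x - y) v + (l - mu) * b_form Om y v by rewrite ebxy; ring.
have b1 := ip_le_norm0 mOm Lxy Lv; have b2 := ip_le_norm0 mOm Ly Lv.
rewrite y1 mul1r in b2.
apply: le_trans (ler_normD _ _) _; rewrite !normrM mulrDl lerD //.
  rewrite -mulrA ler_wpM2l // (le_trans b1) // ler_wpM2l ?norm0_ge0 //.
  exact: norm0_le_norm1.
by rewrite ler_wpM2l // (le_trans b2) // norm0_le_norm1.
Qed.

(** Testing the difference of the equations with [e = x - uh] gives [gip e e <= B * norm1 e]; the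
    Poincare inequality turns the left side into [norm1 e ^+ 2], and one factor is divided out. *)
Lemma fixed_point_error C K (W : set (sob R k.+1)) l mu x y uh :
  (forall v, H01 Om v -> norm1 Om v <= C * normgrad Om v) -> 0 < C ->
  0 < K -> assumptionB Om f K ->
  Defs.subspace W -> W `<=` H01 Om -> W y -> norm0 Om y = 1 ->
  eigenpair Om f W l x -> W uh ->
  (forall v, W v -> gip Om uh v = mu * b_form Om y v - ip Om (fw y) v.1) ->
  norm1 Om (x - uh) <=
    C ^+ 2 * (`|l| * norm0 Om (x - y) + `|l - mu| + K * norm0 Om (x - y)).
Proof.
move=> hC C0 K0 hB sW WH Wy y1 [Wx _ eqx] Wuh eqh.
have We := subspaceB sW Wx Wuh; set e := x - uh in We *.
have Hx := WH _ Wx; have Hy := WH _ Wy; have Huh := WH _ Wuh; have He := WH _ We.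
have [_ _ _ intf] := hf.
have ge : gip Om e e = l * b_form Om x e - mu * b_form Om y e
    - ip Om (fun z => f z (x.1 z) - f z (y.1 z)) e.1.
  have [_ ->] := ipB_integrable (intf _ _ Hx He) (intf _ _ Hy He).
  rewrite {1}/e gipB ?eqh //; try exact: H01_L2sob.
  by rewrite -eqx // a_form_split //; ring.
set B := `|l| * _ + _ + _.
have gB : gip Om e e <= B * norm1 Om e.
  have := b_form_residual l mu (H01_L2sob Hx) (H01_L2sob Hy) (H01_L2sob He) y1.
  have := hB _ _ _ Hx Hy He; rewrite ge /B !ler_norml => /andP[b1 _] /andP[_ b2].
  nra.
have eC := hC _ He.
have : norm1 Om e ^+ 2 <= C ^+ 2 * (B * norm1 Om e).
  apply: le_trans (_ : (C * normgrad Om e) ^+ 2 <= _).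
    by rewrite lerXn2r ?nnegrE ?norm1_ge0 ?mulr_ge0 ?normgrad_ge0 // ltW.
  by rewrite exprMn sqr_sqrtr ?gip_ge0 // ler_wpM2l ?sqr_ge0.
have := norm1_ge0 Om e; rewrite le_eqVlt => /predU1P[<- _|e_gt0].
  by rewrite mulr_ge0 ?sqr_ge0 // !addr_ge0 ?mulr_ge0 ?norm0_ge0 // ltW.
by rewrite mulrA [norm1 Om e ^+ 2]expr2 ler_pM2r.
Qed.

(** The Newton equation is the linearisation at [y]. Subtracted from the equation for [x], it leaves
    the residual of the eigenvalue terms and the Taylor remainder of [f], which assumption C
    bounds. *)
Lemma newton_error K (W : set (sob R k.+1)) l mu x y eh : 0 < K ->
  assumptionC Om f K ->
  Defs.subspace W -> W `<=` H01 Om -> W y -> norm0 Om y = 1 ->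
  eigenpair Om f W l x -> W eh ->
  (forall w, W w -> norm1 Om w <= K *
     sup [set a_lin Om f y w v / norm1 Om v | v in W `&` [set v | norm1 Om v != 0]]) ->
  (forall v, W v -> a_lin Om f y eh v =
     mu * b_form Om y v - gip Om y v - ip Om (fw y) v.1) ->
  norm1 Om (x - (y + eh)) <=
    K * (`|l| * norm0 Om (x - y) + `|l - mu| + K * norm0 Om (x - y)).
Proof.
move=> K0 [intfv hC] sW WH Wy y1 [Wx _ eqx] Weh infsup eqh.
have We := subspaceB sW Wx (subspaceD sW Wy Weh).
have Wxy := subspaceB sW Wx Wy.
have Hx := WH _ Wx; have Hy := WH _ Wy; have Heh := WH _ Weh; have Hxy := WH _ Wxy.
have [_ _ _ intf] := hf.
set e := x - _ in We *; set B := `|l| * _ + _ + _.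
have ee : e = (x - y) - eh by rewrite /e opprD addrA.
have B0 : 0 <= B by rewrite !addr_ge0 ?mulr_ge0 ?norm0_ge0 // ltW.
have aB v : W v -> a_lin Om f y e v <= B * norm1 Om v.
  move=> Wv; have Hv := WH _ Wv.
  have alin : a_lin Om f y e v = a_lin Om f y (x - y) v - a_lin Om f y eh v.
    rewrite /a_lin ee gipB; try exact: H01_L2sob.
    have := ipB_integrable (intfv _ _ _ Hy Hxy Hv) (intfv _ _ _ Hy Heh Hv).
    rewrite (_ : (fun z => _ - _) =
      fun z => f_v f z (y.1 z) * ((x - y) - eh).1 z); last first.
      by apply/funext => z; rewrite -mulrBr.
    by move=> [_ ->]; ring.
  have [i1 ip1] := ipB_integrable (intf _ _ Hx Hv) (intf _ _ Hy Hv).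
  have [i2 ip2] := ipB_integrable i1 (intfv _ _ _ Hy Hxy Hv).
  have -> : a_lin Om f y e v = l * b_form Om x v - mu * b_form Om y v
      - ip Om (fun z => f z (x.1 z) - f z (y.1 z) - f_v f z (y.1 z) * (x.1 z - y.1 z)) v.1.
    rewrite alin eqh // ip2 ip1 -eqx // a_form_split // /a_lin gipB; try exact: H01_L2sob.
    ring.
  have := b_form_residual l mu (H01_L2sob Hx) (H01_L2sob Hy) (H01_L2sob Hv) y1.
  have := hC _ _ _ Hx Hy Hv; rewrite /B !ler_norml => /andP[b1 _] /andP[_ b2].
  nra.
apply: le_trans (infsup _ We) _; rewrite ler_wpM2l ?(ltW K0) //.
(* If all of [W] has [norm1] zero, the supremum is over the empty set and equals 0 by convention. *)
set S := [set _ | _ in _]; have [->|/set0P S0] := eqVneq S set0; first by rewrite sup0.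
apply: ge_sup => // _ [v [Wv v0] <-].
by rewrite ler_pdivrMr ?aB // lt_neqAle eq_sym v0 norm1_ge0.
Qed.

End correction.

(** * The multigrid scheme *)

Section scheme.
Variables (R : realType) (k : nat) (Om : set 'rV[R]_k.+1) (f : 'rV[R]_k.+1 -> R -> R).
Hypotheses (oOm : open Om) (bOm : bounded_set Om) (hf : smooth_nonlinearity Om f).
Let mOm := open_measurable_rV oOm.
Variables (u : sob R k.+1) (appr : set (sob R k.+1) -> R -> sob R k.+1 -> Prop).
Variable eta : set (sob R k.+1) -> R.

(** Gives both steps one error bound, so that the induction over levels need not distinguish them.
    [Q] is chosen before the spaces, from [K] and, for the fixed-point step, the Poincare
    constant. *)
Lemma correction_step_error m K : 0 < K -> correction_assumption Om f u m K ->
  exists2 Q, 0 < Q & forall (VH W W' : set (sob R k.+1)) s s' l x,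
    Defs.subspace W' -> W' `<=` H01 Om -> W' s.2 -> norm0 Om s.2 = 1 ->
    eigenpair Om f W' l x ->
    correction_step Om f u appr eta m K VH W W' s s' ->
    exists ut, [/\ W' ut,
      norm1 Om (x - ut) <=
        Q * (`|l| * norm0 Om (x - s.2) + `|l - s.1| + norm0 Om (x - s.2))
        + K * (eta W * Defs.dist Om W u) &
      appr (add_span VH ut) s'.1 s'.2].
Proof.
move=> K0 hm; have [C C0 hC] := poincare oOm bOm.
have B_le (l mu n0 : R) : 0 <= n0 ->
    `|l| * n0 + `|l - mu| + K * n0 <= (1 + K) * (`|l| * n0 + `|l - mu| + n0).
  move=> n00; have := mulr_ge0 (normr_ge0 l) n00; have := normr_ge0 (l - mu).
  nra.
have split_error (W' : set (sob R k.+1)) (x uh ut : sob R k.+1) : Defs.subspace W' ->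
    W' `<=` H01 Om -> W' x -> W' uh -> W' ut ->
    norm1 Om (x - ut) <= norm1 Om (x - uh) + norm1 Om (uh - ut).
  move=> sW WH Wx Wh Wt; rewrite -[x - ut](subrKA uh).
  have H1 := WH _ (subspaceB sW Wx Wh); have H2 := WH _ (subspaceB sW Wh Wt).
  exact (norm1_triangle mOm (H01_L2sob H1) (H01_L2sob H2)).
case: m hm => [hB|[hC' _]].
- exists (C ^+ 2 * (1 + K)).
    by rewrite mulr_gt0 ?exprn_gt0 // addr_gt0.
  move=> VH W W' s s' l x sW WH Ws s1 ex [uh [ut [Wh eqh Wt ht at_]]].
  exists ut; split => //; have [Wx _ _] := ex.
  apply: le_trans (split_error _ _ _ _ sW WH Wx Wh Wt) _; rewrite lerD //.
  apply: le_trans (fixed_point_error oOm hf hC C0 K0 hB sW WH Ws s1 ex Wh eqh) _.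
  by rewrite -(mulrA (C ^+ 2)) ler_wpM2l ?sqr_ge0 // B_le ?norm0_ge0.
- exists (K * (1 + K)); first by rewrite mulr_gt0 // addr_gt0.
  move=> VH W W' s s' l x sW WH Ws s1 ex [infsup _ [eh [et [Wh eqh Wt ht at_]]]].
  have Wyh := subspaceD sW Ws Wh; have Wyt := subspaceD sW Ws Wt.
  exists (s.2 + et); split => //; have [Wx _ _] := ex.
  apply: le_trans (split_error _ _ _ _ sW WH Wx Wyh Wyt) _.
  rewrite lerD //; last by rewrite opprD addrACA subrr add0r.
  apply: le_trans (newton_error oOm hf K0 hC' sW WH Ws s1 ex Wh infsup eqh) _.
  by rewrite -(mulrA K) ler_wpM2l ?(ltW K0) // B_le ?norm0_ge0.
Qed.

Variables (lam : R) (fam : set (mesh R k.+1)) (lamb : mesh R k.+1 -> R).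
Variables (ub : mesh R k.+1 -> sob R k.+1) (sigma : R).
Hypotheses (hu : eigenpair Om f (H01 Om) lam u) (hfam : mesh_family Om sigma fam).
Hypothesis happr : approximations Om f appr fam lamb ub.
Variables (K : R) (m : correction).
Hypothesis hK : 0 < K.
Hypothesis hA1 : assumptionA1 Om lam u fam lamb ub eta K.
Hypothesis hA2 : assumptionA2 Om appr fam lamb ub eta K.
Hypothesis hm : correction_assumption Om f u m K.
Notation Vh T := (fespace Om T).
Notation delta T := (Defs.dist Om (Vh T) u).

Lemma eigenpair_norm0 W l w : eigenpair Om f W l w -> norm0 Om w = 1.
Proof. by case=> _ bw _; rewrite /norm0 -[ip _ _ _]/(b_form Om w w) bw sqrtr1. Qed.

Lemma fam_fd T : fam T -> fd_subspace Om (Vh T).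
Proof. by move=> fT; apply: fd_subspace_fespace => //; case: hfam => /(_ _ fT)[]. Qed.

Lemma fam_eta_ge0 T : fam T -> 0 <= eta (Vh T).
Proof. by move=> fT; case: hA1 => _ + _ _; apply; exact: fam_fd. Qed.

Lemma fam_delta_ge0 T : fam T -> 0 <= delta T.
Proof. by move=> fT; apply: dist_ge0; have [] := fam_fd fT. Qed.

Lemma fam_direct T : fam T -> eigenpair Om f (Vh T) (lamb T) (ub T).
Proof. by move=> fT; have [h1 h2] := happr; exact/h1/h2. Qed.

Lemma fam_ub_H01 T : fam T -> H01 Om (ub T).
Proof. by move=> /fam_direct[/fespace_H01]. Qed.

Lemma direct_error T : fam T ->
  `|lam - lamb T| + norm0 Om (u - ub T) <= K ^+ 2 * (eta (Vh T) * delta T).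
Proof.
move=> fT; have [/(_ _ fT)[h1 h2] _ _ _] := hA1; apply: le_trans h2 _.
by rewrite expr2 -mulrA ler_wpM2l ?(ltW hK) // mulrCA ler_wpM2l ?fam_eta_ge0.
Qed.

Lemma eta_anti T T' : fam T -> fam T' -> Vh T `<=` Vh T' -> eta (Vh T') <= eta (Vh T).
Proof. by move=> fT fT'; case: hA1 => _ _ _; apply; exact: fam_fd. Qed.

(* The direct errors on both levels are at most K^2 eta(V_T) delta(V_T). *)
Lemma next_level_error T T' (s : R * sob R k.+1) : fam T -> fam T' ->
  Vh T `<=` Vh T' -> H01 Om s.2 ->
  `|lamb T - s.1| + norm0 Om (ub T - s.2) <= eta (Vh T) * delta T ->
  `|lamb T' - s.1| + norm0 Om (ub T' - s.2)
    <= (2 * K ^+ 2 + 1) * (eta (Vh T) * delta T).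
Proof.
move=> fT fT' TT' Hs hs; have e1 := direct_error fT; have e2 := direct_error fT'.
have sT : Defs.subspace (Vh T) by have [] := fam_fd fT.
have d12 : eta (Vh T') * delta T' <= eta (Vh T) * delta T.
  apply: ler_pM; [exact: fam_eta_ge0|exact: fam_delta_ge0|exact: eta_anti|].
  exact: dist_anti.
have Hu : H01 Om u by case: hu.
have sH := subspaceH01 oOm bOm.
have HT := fam_ub_H01 fT; have HT' := fam_ub_H01 fT'.
have n1 : norm0 Om (ub T' - s.2) <=
    norm0 Om (u - ub T') + norm0 Om (u - ub T) + norm0 Om (ub T - s.2).
  rewrite -[ub T' - s.2](subrKA (ub T)) -[ub T' - ub T](subrKA u).
  apply: le_trans (norm0_triangle mOm _ _) _.
  - by apply: (H01_L2sob (subspaceD sH (subspaceB sH HT' Hu) (subspaceB sH Hu HT))).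
  - exact: (H01_L2sob (subspaceB sH HT Hs)).
  rewrite lerD2r; apply: le_trans (norm0_triangle mOm _ _) _.
  - exact: (H01_L2sob (subspaceB sH HT' Hu)).
  - exact: (H01_L2sob (subspaceB sH Hu HT)).
  rewrite lerD2r -[ub T' - u]opprB -scaleN1r norm0_scale ?normrN1 ?mul1r //.
  exact: (H01_L2sob (subspaceB sH Hu HT')).
have n2 : `|lamb T' - s.1| <= `|lam - lamb T'| + `|lam - lamb T| + `|lamb T - s.1|.
  have -> : lamb T' - s.1 = - (lam - lamb T') + (lam - lamb T) + (lamb T - s.1) by ring.
  apply: le_trans (ler_normD _ _) _; rewrite lerD2r.
  by apply: le_trans (ler_normD _ _) _; rewrite normrN.
have {d12} := ler_wpM2l (sqr_ge0 K) d12.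
move: (eta (Vh T) * _) (eta (Vh T') * _) hs e1 e2 n1 n2 => E E'.
move: (norm0 Om (ub T' - s.2)) (norm0 Om (ub T - s.2)) => a b.
move: (norm0 Om (u - ub T')) (norm0 Om (u - ub T)) => a' b'.
move: (`|lamb T' - s.1|) (`|lam - lamb T'|) (`|lam - lamb T|) (`|lamb T - s.1|).
move=> *; lra.
Qed.

(** The correction error contains the direct eigenvalue of the finer level as a factor, which must
    be bounded uniformly in the mesh. Since 0 lies in each space, [delta T] is at most [norm1 u]. *)
Lemma lamb_bounded : exists2 L, 0 < L & forall T, fam T -> eta (Vh T) <= 1 -> `|lamb T| <= L.
Proof.
exists (`|lam| + K ^+ 2 * norm1 Om u + 1).
  by rewrite ltr_wpDl // addr_ge0 // mulr_ge0 ?sqr_ge0 ?norm1_ge0.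
move=> T fT eta1; have e1 := direct_error fT.
have d1 : delta T <= norm1 Om u.
  by have [[V0 _] _ _] := fam_fd fT; have := dist_le Om u V0; rewrite subr0.
have ed : eta (Vh T) * delta T <= norm1 Om u.
  by rewrite -[leRHS]mul1r ler_pM ?fam_eta_ge0 ?fam_delta_ge0.
have := ler_wpM2l (sqr_ge0 K) ed; have := norm0_ge0 Om (u - ub T).
have : `|lamb T| <= `|lam| + `|lam - lamb T|.
  by rewrite -[in leLHS](subKr lam (lamb T)) ler_normB.
lra.
Qed.

Lemma multigrid_error : exists C M : R, [/\ 0 < C, 0 < M &
  forall (beta : R) (n : nat) (TH : mesh R k.+1) (T : nat -> mesh R k.+1)
    (s : nat -> R * sob R k.+1),
  hierarchy Om u fam K beta n TH T ->
  (forall j, (1 <= j < n)%N -> eta (Vh (T j)) <= K * (beta * eta (Vh (T j.+1)))) ->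
  multigrid_scheme Om f u appr lamb ub eta m K n TH T s ->
  C * beta ^+ 2 * eta (Vh TH) < 1 ->
  norm1 Om (ub (T n) - (s n).2) <= M * (beta ^+ 2 * (eta (Vh (T n)) * delta (T n))) /\
  `|lamb (T n) - (s n).1| + norm0 Om (ub (T n) - (s n).2)
    <= eta (Vh (T n)) * delta (T n)].
Proof.
have [Q Q0 hQ] := correction_step_error hK hm.
have [L L0 hL] := lamb_bounded.
(* [L + 1] collects the eigenvalue factor and the remaining terms, [2 * K ^+ 2 + 1] comes from
   [next_level_error], and the last [K] is the multigrid solver error. *)
pose G := Q * ((L + 1) * (2 * K ^+ 2 + 1)) + K.
have G0 : 0 < G by rewrite addr_gt0 // !mulr_gt0 ?addr_gt0 ?mulr_gt0 ?exprn_gt0.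
(* The added 1, with [beta > 1], makes the smallness condition imply [eta (Vh TH) <= 1], as
   [lamb_bounded] requires. *)
exists (K ^+ 4 * G + 1), (K ^+ 3 * G).
split; [by rewrite addr_gt0 // mulr_gt0 // exprn_gt0|by rewrite mulr_gt0 // exprn_gt0|].
move=> beta n TH T s [[n0 beta1] [fTH fT] _ [TH1 TT] ratio] eta_ratio [s1 step] small.
have beta0 : 0 < beta by apply: lt_trans beta1.
have V0 : 0 <= eta (Vh TH) by exact: fam_eta_ge0.
have b2 : 1 <= beta ^+ 2 by rewrite exprn_ege1 // ltW.
have eH1 : eta (Vh TH) <= 1.
  have KG : 1 <= K ^+ 4 * G + 1 by rewrite lerDr mulr_ge0 ?exprn_ge0 ?ltW.
  apply: le_trans (ltW small); rewrite -[leLHS]mul1r ler_wpM2r //.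
  by rewrite -[leLHS]mul1r ler_pM.
have sub j : (1 <= j <= n)%N -> Vh TH `<=` Vh (T j).
  elim: j => [//|[|j] IH jn]; first exact: TH1.
  have jn' : (1 <= j.+1 < n)%N := jn.
  exact: subset_trans (IH (ltnW jn)) (TT _ jn').
suff main j : (1 <= j <= n)%N ->
  [/\ Vh (T j) (s j).2, norm0 Om (s j).2 = 1,
    norm1 Om (ub (T j) - (s j).2) <= K ^+ 3 * G * (beta ^+ 2 * (eta (Vh (T j)) * delta (T j))) &
    `|lamb (T j) - (s j).1| + norm0 Om (ub (T j) - (s j).2)
      <= eta (Vh (T j)) * delta (T j)].
  by have [|_ _ e1 e0] := main n; first by rewrite n0 leqnn.
(* Level 0 is outside the range, and level 1 is the direct solution, with zero errors; the inductive
   step goes from level [j.+1] to [j.+2]. *)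
elim: j => [//|[|j] IH jn].
  have f1 := fT 1%N jn; have e1 := fam_direct f1; rewrite s1 /= !subrr normr0 add0r.
  have e0 := mulr_ge0 (fam_eta_ge0 f1) (fam_delta_ge0 f1).
  have z0 : norm0 Om 0 = 0.
    rewrite -[X in norm0 _ X](scale0r u) norm0_scale ?normr0 ?mul0r //.
    by apply: H01_L2sob; case: hu.
  have z1 : norm1 Om 0 = 0.
    rewrite -[X in norm1 _ X](scale0r u) norm1_scale ?normr0 ?mul0r //.
    by apply: H01_L2sob; case: hu.
  rewrite z0 z1; split => //; [by case: e1|exact: eigenpair_norm0 e1|].
  apply: mulr_ge0; first by rewrite mulr_ge0 ?exprn_ge0 ?ltW.
  by rewrite mulr_ge0 ?sqr_ge0.
have jn1 : (1 <= j.+1 <= n)%N := ltnW jn.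
have jn2 : (1 <= j.+1 < n)%N := jn.
have [Vs s_1 _ hs] := IH jn1.
have fj := fT _ jn1; have fj' := fT _ jn; have VV := TT _ jn2.
have ex := fam_direct fj'; have [Vx _ _] := ex.
have sV : Defs.subspace (Vh (T j.+2)) by have [] := fam_fd fj'.
have [ut [Vt ht aw]] := hQ _ _ _ _ _ _ _ sV (@fespace_H01 _ _ _ _) (VV _ Vs) s_1 ex (step _ jn2).
have Hs := fespace_H01 Vs.
have hD := next_level_error fj fj' VV Hs hs.
set eps := eta (Vh (T j.+1)) * delta (T j.+1) in hs hD ht *.
set eps' := eta (Vh (T j.+2)) * delta (T j.+2).
have eps'0 : 0 <= eps' by rewrite mulr_ge0 ?fam_eta_ge0 ?fam_delta_ge0.
have eps0 : 0 <= eps by rewrite mulr_ge0 ?fam_eta_ge0 ?fam_delta_ge0.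
(* The lower half of [approx_eq] for the distances, multiplied by the assumed ratio of the [eta]. *)
have eps_ratio : eps <= K ^+ 2 * beta ^+ 2 * eps'.
  have [_ [d1 _]] := ratio _ jn2.
  have {}d1 : delta (T j.+1) <= K * beta * delta (T j.+2).
    by move: d1; rewrite !ler_pdivrMl // mulrCA mulrA.
  have -> : K ^+ 2 * beta ^+ 2 * eps' =
    (K * (beta * eta (Vh (T j.+2)))) * (K * beta * delta (T j.+2)) by rewrite /eps'; ring.
  by apply: ler_pM => //; [exact: fam_eta_ge0|exact: fam_delta_ge0|exact: eta_ratio].
have eta'1 : eta (Vh (T j.+2)) <= 1.
  exact: le_trans (eta_anti fTH fj' (sub _ jn)) eH1.
have hut : norm1 Om (ub (T j.+2) - ut) <= G * eps.
  apply: le_trans ht _; rewrite mulrDl lerD2r -!mulrA ler_wpM2l ?(ltW Q0) //.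
  have n00 := norm0_ge0 Om (ub (T j.+2) - (s j.+1).2).
  have := ler_wpM2r n00 (hL _ fj' eta'1).
  have := normr_ge0 (lamb (T j.+2) - (s j.+1).1).
  have := ler_wpM2l (ltW L0) hD; move: hD n00.
  move: (norm0 _ _) (`|lamb _ - _|) (`|lamb _|) => a b c hD n00.
  nra.
have sHV := sub _ jn.
have sVH : Defs.subspace (Vh TH) by have [] := fam_fd fTH.
have sW := subspace_add_span ut sVH; have WV := add_span_sub sV sHV Vt.
have fdW : fd_subspace Om (add_span (Vh TH) ut).
  exact: (fd_subspace_add_span oOm bOm (fam_fd fTH) (fespace_H01 Vt)).
have [w1 w0] := hA2 fj' sW WV aw.
have [Ww _ _] := happr.1 _ _ _ aw.
have Wt : add_span (Vh TH) ut ut.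
  by exists 0, 1; split; [exact: sVH.1|rewrite scale1r add0r].
have hw : norm1 Om (ub (T j.+2) - (s j.+2).2) <= K ^+ 3 * G * (beta ^+ 2 * eps').
  have -> : K ^+ 3 * G * (beta ^+ 2 * eps') = K * (G * (K ^+ 2 * beta ^+ 2 * eps')) by ring.
  apply: le_trans w1 _; rewrite ler_wpM2l ?(ltW hK) //.
  apply: le_trans (dist_le _ _ Wt) _; apply: le_trans hut _.
  by rewrite ler_wpM2l // ltW.
have etaW : eta (add_span (Vh TH) ut) <= eta (Vh TH).
  case: hA1 => _ _ _; apply => //; first exact: fam_fd.
  by move=> v Vv; exists v, 0; rewrite scale0r addr0.
have etaW0 : 0 <= eta (add_span (Vh TH) ut) by case: hA1 => _ + _ _; apply.
split; [exact: WV|exact: eigenpair_norm0 (happr.1 _ _ _ aw)|exact: hw|].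
apply: le_trans w0 _.
apply: le_trans (_ : K * (eta (Vh TH) * (K ^+ 3 * G * (beta ^+ 2 * eps'))) <= _).
  by rewrite ler_wpM2l ?(ltW hK) // ler_pM ?norm1_ge0.
rewrite -[leRHS]mul1r.
have -> : K * (eta (Vh TH) * (K ^+ 3 * G * (beta ^+ 2 * eps')))
  = (K ^+ 4 * G * beta ^+ 2 * eta (Vh TH)) * eps' by ring.
apply: ler_wpM2r; first exact: eps'0.
apply: le_trans (ltW small); apply: ler_wpM2r; first exact: V0.
by apply: ler_wpM2r; rewrite ?sqr_ge0 ?lerDl.
Qed.

End scheme.

Theorem theorem5p1 (R : realType) (d : nat) (hd : d = 2%N \/ d = 3%N)
    (Om : set 'rV[R]_d) (hOm : domain Om)
    (f : 'rV[R]_d -> R -> R) (hf : smooth_nonlinearity Om f)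
    (lam : R) (u : sob R d) (hu : eigenpair Om f (H01 Om) lam u)
    (sigma : R) (fam : set (mesh R d)) (hfam : mesh_family Om sigma fam)
    (appr : set (sob R d) -> R -> sob R d -> Prop)
    (lamb : mesh R d -> R) (ub : mesh R d -> sob R d)
    (happr : approximations Om f appr fam lamb ub)
    (eta : set (sob R d) -> R) (K : R) (hK : 0 < K)
    (hA1 : assumptionA1 Om lam u fam lamb ub eta K)
    (hA2 : assumptionA2 Om appr fam lamb ub eta K)
    (m : correction) (hm : correction_assumption Om f u m K) :
  exists C M : R, [/\ 0 < C, 0 < M &
    forall (beta : R) (n : nat) (TH : mesh R d) (T : nat -> mesh R d)
      (s : nat -> R * sob R d),
    hierarchy Om u fam K beta n TH T ->
    (forall k, (1 <= k < n)%N ->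
      eta (fespace Om (T k)) <= K * (beta * eta (fespace Om (T k.+1)))) ->
    multigrid_scheme Om f u appr lamb ub eta m K n TH T s ->
    C * beta ^+ 2 * eta (fespace Om TH) < 1 ->
    let Vn := fespace Om (T n) in
    norm1 Om (ub (T n) - (s n).2) <= M * (beta ^+ 2 * (eta Vn * dist Om Vn u)) /\
    `|lamb (T n) - (s n).1| + norm0 Om (ub (T n) - (s n).2)
      <= M * (eta Vn * dist Om Vn u)].
Proof.
(* The dimension takes the form [d.+1], which provides a first coordinate for the Poincare
   inequality. *)
case: d hd Om hOm f hf u hu fam hfam appr lamb ub happr eta hA1 hA2 hm => [[]//|d] _.
move=> Om [oOm _ bOm _] f hf u hu fam hfam appr lamb ub happr eta hA1 hA2 hm.
have [C [M [C0 M0 hCM]]] := multigrid_error oOm bOm hf hu hfam happr hK hA1 hA2 hm.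
(* One constant for both estimates: the first holds with [M], the second with 1. *)
exists C, (M + 1); split; [by []|by rewrite addr_gt0|].
move=> beta n TH T s hT he hs small Vn.
have [e1 e0] := hCM _ _ _ _ _ hT he hs small.
have [[n0 beta1] [_ fT] _ _ _] := hT.
have fTn : fam (T n) by apply: fT; rewrite n0 leqnn.
have eps0 : 0 <= eta Vn * Defs.dist Om Vn u.
  apply: mulr_ge0; first exact: (fam_eta_ge0 oOm bOm hfam hA1 fTn).
  exact: (fam_delta_ge0 oOm bOm u hfam fTn).
split.
  by apply: le_trans e1 _; rewrite ler_wpM2r ?lerDl // mulr_ge0 ?sqr_ge0.
apply: le_trans e0 _; rewrite mulrDl mul1r lerDr.
by apply: mulr_ge0; [exact: ltW|exact: eps0].
Qed.
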